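(* Let $K$ be a compact semisimple Lie group with Lie algebra $\mathfrak k\neq 0$, let $\mathfrak h\subseteq\mathfrak k$ be the Lie algebra of a maximal torus of $K$, and let $\mathfrak h^+\subseteq\mathfrak h$ be a (closed) positive Weyl chamber given by a choice of positive roots. Let $\|\cdot\|$ be an $\mathrm{Ad}$-invariant Finsler norm on $\mathfrak k$, let $B=\{v\in\mathfrak k:\|v\|\le 1\}$ be its closed unit ball, and let $\mathrm{bd}\,B^\circ$ be the boundary of the polar dual $B^\circ$ of $B$. Then for every $x\in\mathfrak k$, $$\|x\|=\sup_{\mu\in \mathrm{bd}\,B^\circ\cap\mathfrak h^+}\|x\|_\mu .$$
   Context: A Finsler norm on $\mathfrak k$ is a map $\|\cdot\|:\mathfrak k\to\mathbb R_{\ge 0}$ which is subadditive, non-degenerate ($\|v\|=0$ only if $v=0$) and positively homogeneous ($\|\lambda v\|=\lambda\|v\|$ for $\lambda\ge 0$). It is $\mathrm{Ad}$-invariant if $\|\mathrm{Ad}_k v\|=\|v\|$ for all $k\in K$, $v\in\mathfrak k$. Let $\langle\cdot,\cdot\rangle$ denote the $\mathrm{Ad}$-invariant inner product on $\mathfrak k$ given by minus the Killing form. For $x,\mu\in\mathfrak k$ define $$\|x\|_\mu=\max_{k\in K}\langle x,\mathrm{Ad}_k\mu\rangle.$$ The polar dual of $B\subseteq\mathfrak k$ is $B^\circ=\{\mu\in\mathfrak k:\langle x,\mu\rangle\le 1\text{ for all }x\in B\}$. *)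

(* Defs.v *)
From HB Require Import structures.
From mathcomp Require Import all_boot all_order all_algebra.
From mathcomp Require Import all_classical all_reals all_analysis.

Set Implicit Arguments.
Unset Strict Implicit.
Unset Printing Implicit Defensive.

Import Order.TTheory GRing.Theory Num.Theory.
Import numFieldNormedType.Exports.

Local Open Scope classical_set_scope.
Local Open Scope ring_scope.

(* [Ck k U f] : f is of class C^k on the open set U.  The normed modules below
   are all finite dimensional, so continuity of each directional derivative
   amounts to continuity of the differential. *)
Fixpoint Ck (R : realType) (V W : normedModType R) (k : nat)
    (U : set V) (f : V -> W) : Prop :=
  if k is k'.+1 then
    (forall x, U x -> differentiable f x) /\
    (forall v : V, Ck k' U (fun x => 'D_v f x))
  else forall x, U x -> {for x, continuous f}.

Definition smooth_on (R : realType) (V W : normedModType R)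
    (U : set V) (f : V -> W) : Prop := forall k, Ck k U f.

(* A chart: a homeomorphism from the open set [chart_dom] onto the open subset
   [chart_cod] of R^n.  Both maps are total; their values outside these sets
   are irrelevant. *)
Record chart (R : realType) (n : nat) (K : topologicalType) := Chart {
  chart_dom : set K;
  chart_cod : set 'rV[R]_n;
  coord : K -> 'rV[R]_n;
  param : 'rV[R]_n -> K;
  open_chart_dom : open chart_dom;
  open_chart_cod : open chart_cod;
  coord_cod : forall p, chart_dom p -> chart_cod (coord p);
  param_dom : forall x, chart_cod x -> chart_dom (param x);
  coordK : forall p, chart_dom p -> param (coord p) = p;
  paramK : forall x, chart_cod x -> coord (param x) = x;
  coord_continuous : forall p, chart_dom p -> {for p, continuous coord};
  param_continuous : forall x, chart_cod x -> {for x, continuous param}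
}.

HB.mixin Record isLieGroup (R : realType) (n : nat) K
    of Group K & Topological K := {
  lie_hausdorff : hausdorff_space K;
  lie_second_countable : @second_countable K;
  atlas : set (chart R n K);
  atlas_cover : forall p : K, exists2 a, atlas a & chart_dom a p;
  atlas_compat : forall a b, atlas a -> atlas b ->
    smooth_on [set x | chart_cod a x /\ chart_dom b (param a x)]
      (fun x => coord b (param a x));
  lie_mul_continuous : continuous (fun p : K * K => (p.1 * p.2)%g);
  lie_inv_continuous : continuous (fun p : K => (p^-1)%g);
  lie_mul_smooth : forall a b c, atlas a -> atlas b -> atlas c ->
    smooth_on
      [set z : 'rV[R]_n * 'rV[R]_n | [/\ chart_cod a z.1, chart_cod b z.2 &
         chart_dom c (param a z.1 * param b z.2)%g]]
      (fun z => coord c (param a z.1 * param b z.2)%g);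
  lie_inv_smooth : forall a b, atlas a -> atlas b ->
    smooth_on [set x | chart_cod a x /\ chart_dom b ((param a x)^-1)%g]
      (fun x => coord b ((param a x)^-1)%g)
}.

(* n-dimensional real Lie groups *)
#[short(type="lieGroupType")]
HB.structure Definition LieGroup (R : realType) (n : nat) :=
  {K of isLieGroup R n K & Group K & Topological K}.

Section LieAlgebra.
Context (R : realType) (n : nat) (K : lieGroupType R n).

Definition chart_at_1 (c : chart R n K) : Prop :=
  atlas c /\ chart_dom c 1%g.

(* The Lie algebra is the tangent space of K at 1; a chart c around 1
   identifies it with R^n, and every notion below is read through c. *)
Variable c : chart R n K.

(* Ad_k is the differential at 1 of p |-> k p k^-1. *)
Definition Ad (k : K) (v : 'rV[R]_n) : 'rV[R]_n :=
  'D_v (fun x => coord c (k * param c x * k^-1)%g) (coord c 1%g).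

(* [v, w] = ad_v w, where ad is the differential of k |-> Ad_k at 1. *)
Definition bracket (v w : 'rV[R]_n) : 'rV[R]_n :=
  'D_v (fun x => Ad (param c x) w) (coord c 1%g).

Definition killing (v w : 'rV[R]_n) : R :=
  \tr (lin1_mx (bracket v \o bracket w)).

Definition inner (v w : 'rV[R]_n) : R := - killing v w.

(* no nonzero abelian ideal *)
Definition semisimple : Prop :=
  forall I : {vspace 'rV[R]_n},
    (forall v w, w \in I -> bracket v w \in I) ->
    (forall v w, v \in I -> w \in I -> bracket v w = 0) ->
    I = 0%VS.

Definition subgroup (T : set K) : Prop :=
  [/\ T 1%g, forall p q, T p -> T q -> T (p * q)%g &
      forall p, T p -> T (p^-1)%g].

Definition torus (T : set K) : Prop :=
  [/\ subgroup T, compact T, connected T &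
      forall p q, T p -> T q -> (p * q = q * p)%g].

Definition maximal_torus (T : set K) : Prop :=
  torus T /\ (forall T', torus T' -> T `<=` T' -> T' = T).

Definition one_param_subgroup (g : R -> K) : Prop :=
  continuous g /\ forall s t, g (s + t) = (g s * g t)%g.

(* Lie algebra of a closed subgroup: the initial velocities of the
   one-parameter subgroups of K contained in T *)
Definition lie_subalgebra (T : set K) : set 'rV[R]_n :=
  [set v | exists g : R -> K,
     [/\ one_param_subgroup g, (forall t, T (g t)) &
         is_derive (0 : R) (1 : R) (fun t => coord c (g t)) v]].

Section Roots.
Variable h : set 'rV[R]_n.

(* Real roots of k with respect to h: alpha is nonzero on h, and some nonzero
   X + iY in the complexification satisfies
   [H, X + iY] = i alpha(H) (X + iY) for all H in h.  A functional on h is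
   represented by any of its linear extensions to k. *)
Definition real_root (alpha : {scalar 'rV[R]_n}) : Prop :=
  (exists2 H, h H & alpha H != 0) /\
  exists X Y : 'rV[R]_n, (X, Y) != 0 /\
    forall H, h H -> bracket H X = - alpha H *: Y /\
                     bracket H Y = alpha H *: X.

(* A choice of positive roots: those positive at some regular element of h
   (regular: no root vanishes there), i.e. on one open Weyl chamber *)
Definition positive_roots (P : set {scalar 'rV[R]_n}) : Prop :=
  exists2 xi, h xi /\ (forall alpha, real_root alpha -> alpha xi != 0) &
    P = [set alpha | real_root alpha /\ 0 < alpha xi].

Definition weyl_chamber (P : set {scalar 'rV[R]_n}) : set 'rV[R]_n :=
  [set H | h H /\ forall alpha : {scalar 'rV[R]_n}, P alpha -> 0 <= alpha H].

End Roots.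

Definition finsler_norm (N : 'rV[R]_n -> R) : Prop :=
  [/\ forall v, 0 <= N v,
      forall v w, N (v + w) <= N v + N w,
      forall v, N v = 0 -> v = 0 &
      forall (l : R) v, 0 <= l -> N (l *: v) = l * N v].

Definition Ad_invariant (N : 'rV[R]_n -> R) : Prop :=
  forall k v, N (Ad k v) = N v.

(* The supremum is a maximum, since k |-> Ad_k mu is continuous and K is
   compact. *)
Definition orbit_norm (mu x : 'rV[R]_n) : R :=
  sup [set inner x (Ad k mu) | k in [set: K]].

Definition polar (B : set 'rV[R]_n) : set 'rV[R]_n :=
  [set mu | forall x, B x -> inner x mu <= 1].

End LieAlgebra.

Definition unit_ball (R : realType) (n : nat) (N : 'rV[R]_n -> R) :
  set 'rV[R]_n := [set v | N v <= 1].

Definition boundary (T : topologicalType) (A : set T) : set T :=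
  closure A `\` interior A.

(* Main.v *)
(** Write [<.,.>] for minus the Killing form.  If [mu] lies in the polar dual and
    [<x, mu>] is the maximum of [<x, .>] there, then this maximum is [N x] by
    polar duality and [mu] is a boundary point; as the polar dual is invariant
    under [Ad], everything reduces to showing that each orbit [Ad_K mu] meets
    the closed chamber of a regular element [xi].  Move [mu] along its orbit so
    as to maximise [<mu, xi>].  The first-order condition is [[xi, mu] = 0] and
    the second-order condition [<[v, mu], [v, xi]> >= 0], applied to root
    vectors [v], says that every positive root is nonnegative at [mu].  There
    remains to see that the centraliser of [xi] is the Lie algebra of the
    maximal torus.

    The Lie theory needed is obtained without differential equations or Haar
    measure.  Since the centre of the Lie algebra is trivial, [Ad_k - 1]
    controls the coordinates of [k] near [1]; hence if [q_i -> 1] with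
    [coord q_i / eps_i -> u], the ultralimits of [q_i ^ floor (t / eps_i)] form
    a one-parameter subgroup with velocity [u], contained in any closed subgroup
    which contains the [q_i].  This yields both the exponential map and the
    needed case of the closed subgroup theorem. *)
From HB Require Import structures.
From mathcomp Require Import all_boot all_order all_algebra.
From mathcomp Require Import all_classical all_reals all_analysis.
From mathcomp Require Import ring lra.
Require Import Defs.
Import Order.TTheory GRing.Theory Num.Theory.
Import numFieldNormedType.Exports.
Local Open Scope classical_set_scope.
Local Open Scope ring_scope.

Set Implicit Arguments.
Unset Strict Implicit.
Unset Printing Implicit Defensive.

(** * Differentiation and matrix norms *)

(** The obstacle is that everything is defined by limits in one chart, so facts about a group
    element are extracted from the matrix [AdM k]. Compactness bounds these matrices, hence powers
    obey estimates linear and quadratic in [m * |AdM k - 1|]. An ultrafilter selects the limits for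
    all times [t] at once, so additivity in [t] follows from continuity of the product.

    Positivity of minus the Killing form only requires, for each [v] separately, some inner product
    for which [ad_v] is skew; averaging over powers of one element is therefore enough.

    The centraliser of [xi] is treated in two halves. A vector commuting with [xi] commutes with all
    of [h], since otherwise a root would vanish at [xi]. A vector [w] commuting with [h] generates
    together with [T] a torus containing [T]. The second half needs [Ad_p w = w] for all [p] in [T],
    although [T] is not known to be covered by its one-parameter subgroups; this is why stabilisers
    are studied near 1.

    The second-order condition comes from maximality at [k] and at [k^-1] together, with no second
    derivative. *)

Section Calculus.
Context (R : realType).

Lemma near_eq_differentiable (V W : normedModType R) (f g : V -> W) x :
  (\near x, f x = g x) -> differentiable f x -> differentiable g x.
Proof.
move=> fg df.
have fgx : f x = g x := nbhs_singleton fg.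
have E : g \o shift x = cst (g x) + 'd f x +o_ 0 id.
  apply/eqaddoP => _/posnumP[e].
  have /diff_locally/eqaddoP/(_ e%:num (gt0 e)) := df.
  have fg0 : \forall y \near (0 : V), f (y + x) = g (y + x).
    move: fg; rewrite (near_shift 0) /=; apply: filterS => y.
    by rewrite /= subr0.
  apply: filterS2 fg0 => y fgy /=.
  by rewrite !fctE /= -fgx -fgy.
apply/diff_locallyP; rewrite (diff_unique (diff_continuous df) E).
by split; [exact: diff_continuous|].
Qed.

Lemma derive_comp (U V W : normedModType R) (f : U -> V) (g : V -> W) x v :
  differentiable f x -> differentiable g (f x) ->
  'D_v (g \o f) x = 'D_('D_v f x) g (f x).
Proof.
move=> df dg; rewrite deriveE; last exact: differentiable_comp.
by rewrite diff_comp // !deriveE.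
Qed.

Lemma differentiable_near (V W : normedModType R) (f : V -> W) x (e : R) :
  differentiable f x -> 0 < e ->
  \forall y \near x, `|f y - f x - 'd f x (y - x)| <= e * `|y - x|.
Proof.
move=> df e0; have /diff_locally/eqaddoP/(_ e e0) := df.
rewrite [X in _ -> X](near_shift 0) /=; apply: filterS => y /=.
by rewrite !fctE /= subr0 addrK opprD addrA.
Qed.
End Calculus.

Lemma ultra_fmap T U (f : T -> U) (F : set_system T) :
  UltraFilter F -> UltraFilter (f @ F).
Proof.
move=> FU; split; first exact: fmap_proper_filter.
move=> G GF FG; rewrite eqEsubset; split => // A GA.
have [//|FnA] := in_ultra_setVsetC (f @^-1` A) FU.
have GnA : G (~` A) by apply: FG.
by have /filter_ex [x []] : G (A `&` ~` A) by exact: filterI.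
Qed.

Section MatrixNorm.
Context (R : realType).

Lemma mx_norm_entry m n (A : 'M[R]_(m, n)) i j : `|A i j| <= `|A|.
Proof.
rewrite [leRHS]/Num.norm /= mx_normrE; apply/bigmax_geP; right => /=.
by exists (i, j).
Qed.

Lemma mx_norm_leP m n (A : 'M[R]_(m, n)) a : 0 <= a ->
  (forall i j, `|A i j| <= a) -> `|A| <= a.
Proof.
by move=> a0 Aa; rewrite [leLHS]/Num.norm /= mx_normrE bigmax_le.
Qed.

Lemma mx_normM m n p (A : 'M[R]_(m, n)) (B : 'M[R]_(n, p)) :
  `|A *m B| <= n%:R * `|A| * `|B|.
Proof.
apply: mx_norm_leP => [|i j]; first by rewrite !mulr_ge0.
rewrite mxE (le_trans (ler_norm_sum _ _ _)) //.
have -> : n%:R * `|A| * `|B| = \sum_(k < n) `|A| * `|B|.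
  by rewrite sumr_const card_ord -mulrA mulr_natl.
by apply: ler_sum => k _; rewrite normrM ler_pM // mx_norm_entry.
Qed.

Lemma mxvec_norm m n (A : 'M[R]_(m, n)) : `|mxvec A| <= `|A|.
Proof.
apply: mx_norm_leP => // i j; rewrite ord1.
by case/mxvec_indexP: j => i' j'; rewrite mxvecE mx_norm_entry.
Qed.

Lemma cvg_mulmx T (F : set_system T) {FF : Filter F} m n p
    (f : T -> 'M[R]_(m, n)) (g : T -> 'M[R]_(n, p)) (A : 'M[R]_(m, n)) (B : 'M[R]_(n, p)) :
  f @ F --> A -> g @ F --> B -> (fun x => f x *m g x) @ F --> A *m B.
Proof.
move=> fA gB.
suff D0 : ((f x - A) *m g x + A *m (g x - B)) @[x --> F] --> (0 : 'M[R]_(m, p)).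
  have := cvgD (@cvg_cst _ (A *m B) _ F FF) D0; rewrite addr0 => H.
  apply: cvg_trans; last exact: H.
  apply: near_eq_cvg; apply: nearW => x /=.
  by rewrite !fctE /= mulmxBl mulmxBr subrKA addrC subrK.
apply: norm_cvg0.
apply: (@squeeze_cvgr _ _ _ _ (cst 0) (fun x => n%:R * `|f x - A| * `|g x| + n%:R * `|A| * `|g x - B|)).
- apply: nearW => x; rewrite normr_ge0 /=.
  by rewrite (le_trans (ler_normD _ _)) // lerD // mx_normM.
- exact: cvg_cst.
- have f0 : `|f x - A| @[x --> F] --> (0 : R).
    by apply/norm_cvg0P; rewrite -(subrr A); apply: cvgB fA _; exact: cvg_cst.
  have g0 : `|g x - B| @[x --> F] --> (0 : R).
    by apply/norm_cvg0P; rewrite -(subrr B); apply: cvgB gB _; exact: cvg_cst.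
  have -> : 0 = n%:R * 0 * `|B| + n%:R * `|A| * 0 :> R by rewrite mulr0 mul0r add0r mulr0.
  apply: cvgD; apply: cvgM => //; try exact: cvg_cst.
    by apply: cvgM => //; exact: cvg_cst.
  exact: cvg_norm.
Qed.

Lemma cvg_mxP T (F : set_system T) {FF : Filter F} m n (f : T -> 'M[R]_(m, n)) (A : 'M[R]_(m, n)) :
  f @ F --> A <-> forall i j, f x i j @[x --> F] --> A i j.
Proof.
split=> [fA i j|fA].
  apply/cvgrPdist_le => e e0; move/cvgrPdist_le/(_ e e0): fA.
  apply: filterS => x; apply: le_trans.
  by have := mx_norm_entry (A - f x) i j; rewrite !mxE.
apply/cvgrPdist_le => e e0.
have : \forall x \near F, forall i j, `|A i j - f x i j| <= e.
  apply: filter_forall => i; apply: filter_forall => j.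
  by have /cvgrPdist_le := fA i j; apply.
by apply: filterS => x H; apply: mx_norm_leP => [|i j]; [exact: ltW|rewrite !mxE].
Qed.

(** Each entry stays in a compact segment, where every ultrafilter converges. All ultralimits of
    vectors and matrices below come from here. *)
Lemma ultra_bounded_cvg T (F : set_system T) {FF : UltraFilter F} m n
    (f : T -> 'M[R]_(m, n)) C : (\forall x \near F, `|f x| <= C) ->
  exists A : 'M[R]_(m, n), f @ F --> A.
Proof.
move=> fC.
have H i j : exists a : R, f x i j @[x --> F] --> a.
  have U := ultra_fmap (fun x => f x i j) FF.
  have := @segment_compact R (- C) C; rewrite compact_ultra => /(_ _ U).
  case; last by move=> a [_ fa]; exists a.
  apply: filterS fC => x; rewrite /= in_itv /= -ler_norml; apply: le_trans.
  exact: mx_norm_entry.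
exists (\matrix_(i, j) sval (cid (H i j))); apply/cvg_mxP => i j.
by rewrite mxE; exact: (svalP (cid (H i j))).
Qed.
End MatrixNorm.

(** * The adjoint action in a chart *)

Section AdjointAction.
Context (R : realType) (n : nat) (K : lieGroupType R n) (c : chart R n K).
Hypothesis hc : chart_at_1 c.

Notation e := (coord c 1%g).

Lemma cvg_mulg T (F : set_system T) {FF : Filter F} (f g : T -> K) a b :
  f @ F --> a -> g @ F --> b -> (fun x => f x * g x)%g @ F --> (a * b)%g.
Proof.
by move=> fa gb; apply: (cvg_comp2 fa gb) (lie_mul_continuous (a, b)).
Qed.

Lemma cvg_invg T (F : set_system T) {FF : Filter F} (f : T -> K) a :
  f @ F --> a -> (fun x => (f x)^-1)%g @ F --> (a^-1)%g.
Proof.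
move=> fa; have H := @lie_inv_continuous R n K a.
exact: cvg_comp fa H.
Qed.

Lemma param_coord1 : param c e = 1%g.
Proof. exact: coordK hc.2. Qed.

Lemma chart_cod1 : chart_cod c e.
Proof. exact: coord_cod hc.2. Qed.

Lemma near_chart_cod : \forall x \near e, chart_cod c x.
Proof. by apply: open_nbhs_nbhs; split; [exact: open_chart_cod|exact: chart_cod1]. Qed.

Lemma param_cvg1 : param c x @[x --> e] --> (1%g : K).
Proof.
have : param c x @[x --> e] --> param c e by exact: (param_continuous chart_cod1).
by rewrite param_coord1.
Qed.

Lemma chart_dom_near (a : chart R n K) k : chart_dom a k -> \forall x \near k, chart_dom a x.
Proof. by move=> ak; by apply: open_nbhs_nbhs; split; [exact: open_chart_dom|]. Qed.

Lemma mul_differentiable (a b d : chart R n K) z : atlas a -> atlas b -> atlas d ->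
  chart_cod a z.1 -> chart_cod b z.2 -> chart_dom d (param a z.1 * param b z.2)%g ->
  differentiable (fun z => coord d (param a z.1 * param b z.2)%g) z.
Proof.
move=> ha hb hd h1 h2 h3.
have [D _] : Ck 1 _ _ := lie_mul_smooth a b d ha hb hd 1.
exact: D.
Qed.

(** Smoothness of the product is only given in charts, and [k] may lie outside [c]. Conjugation is
    therefore factored into two products, read in charts around [k] and [k^-1]. *)
Lemma conj_differentiable (k : K) :
  differentiable (fun x => coord c (k * param c x * k^-1)%g) e.
Proof.
have [a aa ak] := atlas_cover k; have [b ab bk] := atlas_cover (k^-1)%g.
pose mul1 := fun z : 'rV[R]_n * 'rV[R]_n => coord a (param a z.1 * param c z.2)%g.
pose mul2 := fun z : 'rV[R]_n * 'rV[R]_n => coord c (param a z.1 * param b z.2)%g.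
pose F1 x := mul1 (coord a k, x).
pose F2 x := mul2 (x, coord b k^-1%g).
have F1e : F1 e = coord a k by rewrite /F1 /mul1 /= param_coord1 coordK // mulg1.
have dF1 : differentiable F1 e.
  apply: (@differentiable_comp _ _ _ _ (pair (coord a k)) mul1).
    exact: differentiable_pair.
  apply: mul_differentiable => //=; first exact: hc.1.
  - exact: coord_cod.
  - exact: chart_cod1.
  - by rewrite param_coord1 mulg1 coordK.
have dF2 : differentiable F2 (F1 e).
  rewrite F1e; apply: (@differentiable_comp _ _ _ _ (pair^~ (coord b k^-1%g)) mul2).
    exact: differentiable_pair.
  apply: mul_differentiable => //=; first exact: hc.1.
  - exact: coord_cod.
  - exact: coord_cod.
  - by rewrite !coordK // mulgV; exact: hc.2.
apply: near_eq_differentiable (differentiable_comp dF1 dF2).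
have cv : (k * param c x)%g @[x --> e] --> k.
  have := cvg_mulg (@cvg_cst _ k _ (nbhs e) _) param_cvg1.
  by rewrite mulg1 => H; exact: H.
have near_dom : \forall x \near e, chart_dom a (k * param c x)%g := cv _ (chart_dom_near ak).
apply: filterS near_dom => x dx.
by rewrite /F2 /mul2 /F1 /mul1 /= !coordK.
Qed.

Lemma AdE k v :
  Ad c k v = 'd (fun x => coord c (k * param c x * k^-1)%g) e v.
Proof. by rewrite -deriveE //; exact: conj_differentiable. Qed.

Lemma Ad_is_linear k : linear (Ad c k).
Proof. by move=> a u v; rewrite !AdE linearP. Qed.

Lemma Ad_mul k l v : Ad c (k * l)%g v = Ad c k (Ad c l v).
Proof.
pose C k x := coord c (k * param c x * k^-1)%g.
have Ce m : C m e = e by rewrite /C param_coord1 mulg1 mulgV.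
transitivity ('D_v (C k \o C l) e); last first.
  by rewrite derive_comp ?Ce //; exact: conj_differentiable.
apply: near_eq_derive.
have cv : (l * param c x * l^-1)%g @[x --> e] --> (1%g : K).
  have := cvg_mulg (cvg_mulg (@cvg_cst _ l _ (nbhs e) _) param_cvg1)
    (@cvg_cst _ (l^-1)%g _ (nbhs e) _).
  by rewrite mulg1 mulgV => H; exact: H.
have near_dom : \forall x \near e, chart_dom c (l * param c x * l^-1)%g.
  exact: cv _ (chart_dom_near hc.2).
apply: filterS near_dom => x dx.
by rewrite /C /= coordK // invgM !mulgA.
Qed.

Lemma Ad_1 v : Ad c 1%g v = v.
Proof.
rewrite /Ad -[RHS](derive_id e); apply: near_eq_derive.
apply: filterS near_chart_cod => x cx.
by rewrite invg1 mulg1 mul1g paramK.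
Qed.

Lemma sum_pairl0 (V W : nmodType) I (r : seq I) (f : I -> V) :
  (\sum_(i <- r) f i, 0 : W) = \sum_(i <- r) (f i, 0 : W).
Proof.
elim: r => [|i r IH]; first by rewrite !big_nil.
by rewrite !big_cons -IH /GRing.add /= /add_pair /= addr0.
Qed.

Let m (z : 'rV[R]_n * 'rV[R]_n) := coord c (param c z.1 * param c z.2)%g.
Let Om (z : 'rV[R]_n * 'rV[R]_n) := [/\ chart_cod c z.1, chart_cod c z.2 &
  chart_dom c (param c z.1 * param c z.2)%g].

Let m_diff z : Om z -> differentiable m z.
Proof. by case=> *; apply: mul_differentiable => //; exact: hc.1. Qed.

Let dm_diff z v : Om z -> differentiable ('D_v m) z.
Proof.
move=> Oz.
have [_ /(_ v) [D _]] : Ck 2 _ _ := lie_mul_smooth c c c hc.1 hc.1 hc.1 2.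
exact: D.
Qed.

Let Om_e x : chart_cod c x -> Om (x, e).
Proof.
move=> cx; split => //=; first exact: chart_cod1.
by rewrite param_coord1 mulg1; exact: param_dom.
Qed.

Let Om_inv x : chart_cod c x -> chart_dom c (param c x)^-1%g ->
  Om (x, coord c (param c x)^-1%g).
Proof.
move=> cx dx; split => //=; first exact: coord_cod.
by rewrite coordK // mulgV; exact: hc.2.
Qed.

Lemma derive_pairl (V W W' : normedModType R) (f : V * W -> W') (x : V) (y w : W) :
  differentiable f (x, y) -> 'D_w (fun y => f (x, y)) y = 'D_(0, w) f (x, y).
Proof.
move=> df.
have dP : differentiable (fun y : W => (x, y)) y by exact: differentiable_pair.
rewrite (@derive_comp _ _ _ _ (fun y => (x, y)) f) // [X in 'D_X f _](_ : _ = (0, w)) //.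
by rewrite deriveE // (@diff_pair _ _ _ _ (cst x) id) // diff_cst diff_val.
Qed.

Lemma derive_pairr (V W W' : normedModType R) (f : V * W -> W') (x v : V) (y : W) :
  differentiable f (x, y) -> 'D_v (fun x => f (x, y)) x = 'D_(v, 0) f (x, y).
Proof.
move=> df.
have dP : differentiable (fun x : V => (x, y)) x by exact: differentiable_pair.
rewrite (@derive_comp _ _ _ _ (fun x => (x, y)) f) // [X in 'D_X f _](_ : _ = (v, 0)) //.
by rewrite deriveE // (@diff_pair _ _ _ _ id (cst y)) // diff_cst diff_val.
Qed.

(** Conjugation is a left translation followed by a right translation. Expanding the intermediate
    vector in the standard basis leaves only derivatives of [m] in fixed directions, to which the
    C^2 hypothesis on the product applies. *)
Let Ad_param x w : chart_cod c x -> chart_dom c (param c x)^-1%g ->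
  Ad c (param c x) w =
  \sum_i ('D_(0, w) m (x, e)) 0 i *:
     'D_(delta_mx 0 i, 0) m (x, coord c (param c x)^-1%g).
Proof.
move=> cx dx; set y := coord c (param c x)^-1%g.
have Oe := Om_e cx; have Oi := Om_inv cx dx.
have mxe : m (x, e) = x by rewrite /m /= param_coord1 mulg1 paramK.
have dl : differentiable (fun y => m (x, y)) e.
  apply: (@differentiable_comp _ _ _ _ (pair x) m); first exact: differentiable_pair.
  exact: m_diff.
have dr : differentiable (fun z => m (z, y)) (m (x, e)).
  rewrite mxe; apply: (@differentiable_comp _ _ _ _ (pair^~ y) m).
    exact: differentiable_pair.
  exact: m_diff.
transitivity ('D_('D_(0, w) m (x, e)) (fun z => m (z, y)) (m (x, e))).
  rewrite -derive_pairl; last exact: m_diff.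
  rewrite -(derive_comp w dl dr); apply/near_eq_derive.
  have cv : (param c x * param c z)%g @[z --> e] --> (param c x * 1)%g.
    exact: cvg_mulg (@cvg_cst _ _ _ (nbhs e) _) param_cvg1.
  have near_dom : \forall z \near e, chart_dom c (param c x * param c z)%g.
    by apply: cv; rewrite mulg1; apply/chart_dom_near/param_dom.
  apply: filterS near_dom => z dz.
  by rewrite /= /m /= coordK // /y coordK.
rewrite mxe derive_pairr; last exact: m_diff.
have dm := m_diff Oi.
rewrite deriveE // {1}(row_sum_delta ('D_(0, w) m (x, e))).
rewrite sum_pairl0.
rewrite linear_sum; apply: eq_bigr => i _.
rewrite (deriveE _ dm) -linearZ; congr ('d _ _ _).
by rewrite [RHS]/GRing.scale /= /scale_pair /= scaler0.
Qed.

Lemma Ad_param_differentiable w : differentiable (fun x => Ad c (param c x) w) e.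
Proof.
have dinv : differentiable (fun x => coord c (param c x)^-1%g) e.
  have [D _] : Ck 1 _ _ := lie_inv_smooth c c hc.1 hc.1 1.
  by apply: D => /=; split; [exact: chart_cod1|rewrite param_coord1 invg1; exact: hc.2].
have near_inv : \forall x \near e, chart_dom c (param c x)^-1%g.
  have cv : (param c x)^-1%g @[x --> e] --> (1^-1 : K)%g by exact: cvg_invg param_cvg1.
  by apply: cv; rewrite invg1; apply/chart_dom_near/hc.2.
pose G x := \sum_(i < n) \sum_(j < n) (('D_(0, w) m (x, e)) 0 i *
     ('D_(delta_mx 0 i, 0) m (x, coord c (param c x)^-1%g)) 0 j) *: (delta_mx 0 j : 'rV[R]_n).
apply: (@near_eq_differentiable _ _ _ G).
  apply: filterS2 near_chart_cod near_inv => x cx dx.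
  rewrite Ad_param // /G; apply: eq_bigr => i _.
  under eq_bigr do rewrite -scalerA.
  by rewrite -scaler_sumr -row_sum_delta.
have -> : G = \sum_(i < n) \sum_(j < n) (fun x => (('D_(0, w) m (x, e)) 0 i *
     ('D_(delta_mx 0 i, 0) m (x, coord c (param c x)^-1%g)) 0 j) *: (delta_mx 0 j : 'rV[R]_n)).
  by apply/funext => x; rewrite /G fct_sumE; apply: eq_bigr => i _; rewrite fct_sumE.
apply: differentiable_sum => i; apply: differentiable_sum => j.
apply: differentiableZl; apply: differentiableM.
  apply: (@differentiable_comp _ _ _ _ (fun x => 'D_(0, w) m (x, e))
    (fun M : 'rV[R]_n => M 0 i)); last exact: differentiable_coord.
  apply: (@differentiable_comp _ _ _ _ (pair^~ e) ('D_(0, w) m)).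
    exact: differentiable_pair.
  exact/dm_diff/Om_e/chart_cod1.
apply: (@differentiable_comp _ _ _ _
  (fun x => 'D_(delta_mx 0 i, 0) m (x, coord c (param c x)^-1%g))
  (fun M : 'rV[R]_n => M 0 j)); last exact: differentiable_coord.
apply: (@differentiable_comp _ _ _ _ (fun x => (x, coord c (param c x)^-1%g)) ('D_(delta_mx 0 i, 0) m)).
  exact: differentiable_pair.
by apply/dm_diff/Om_inv; [exact: chart_cod1|rewrite param_coord1 invg1; exact: hc.2].
Qed.
End AdjointAction.

(** * The bracket *)

Section LinearRow.
Context (R : realType).

Lemma mul_rV_linear m n (f : 'rV[R]_m -> 'rV[R]_n) u : linear f -> u *m lin1_mx f = f u.
Proof.
move=> lf; pose fM := GRing.isLinear.Build _ _ _ _ _ lf.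
pose fL : {linear 'rV[R]_m -> 'rV[R]_n} := HB.pack f fM.
exact: (mul_rV_lin1 fL).
Qed.

Lemma linear_rV_bounded n (V : normedModType R) (f : 'rV[R]_n -> V) : linear f ->
  exists2 C, 0 <= C & forall x, `|f x| <= C * `|x|.
Proof.
move=> lf; pose fM := GRing.isLinear.Build _ _ _ _ _ lf.
pose fL : {linear 'rV[R]_n -> V} := HB.pack f fM.
exists (\sum_i `|f (delta_mx 0 i)|); first exact: sumr_ge0.
move=> x; rewrite {1}(row_sum_delta x) -[f]/(fL : _ -> _) linear_sum.
rewrite (le_trans (ler_norm_sum _ _ _)) // mulr_suml; apply: ler_sum => i _.
by rewrite linearZ normrZ mulrC ler_wpM2l // mx_norm_entry.
Qed.

Lemma cvg_linear_rV n (V : normedModType R) (f : 'rV[R]_n -> V)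
    T (F : set_system T) {FF : Filter F} (g : T -> 'rV[R]_n) (a : 'rV[R]_n) :
  linear f -> g @ F --> a -> f (g x) @[x --> F] --> f a.
Proof.
move=> lf ga; have [C C0 fC] := linear_rV_bounded lf.
have C1 : 0 < C + 1 by rewrite ltr_wpDl.
apply/cvgrPdist_le => d d0.
have fB x y : f x - f y = f (x - y) by have := lf (-1) y x; rewrite !scaleN1r ![- _ + _]addrC.
move/cvgrPdist_le : ga => /(_ (d / (C + 1)) (divr_gt0 d0 C1)); apply: filterS => x.
rewrite ler_pdivlMr // fB => H; apply: le_trans (fC _) (le_trans _ H).
by rewrite mulrC ler_wpM2l // lerDl.
Qed.

(** A chain rule along an arbitrary filter: [x] need not be a curve, only its rescaled increments
    must converge. This form applies to ultrafilters. *)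
Lemma cvg_diff_quot n (V : normedModType R) (f L : 'rV[R]_n -> V) (a : 'rV[R]_n)
    T (F : set_system T) {FF : Filter F} (eps : T -> R) (x : T -> 'rV[R]_n) (u : 'rV[R]_n) :
  linear L ->
  (forall d, 0 < d -> \forall y \near a, `|f y - f a - L (y - a)| <= d * `|y - a|) ->
  x @ F --> a -> (eps i)^-1 *: (x i - a) @[i --> F] --> u ->
  (eps i)^-1 *: (f (x i) - f a) @[i --> F] --> L u.
Proof.
move=> lL fL xa xu.
suff D0 : (eps i)^-1 *: (f (x i) - f a) - L ((eps i)^-1 *: (x i - a)) @[i --> F] --> (0 : V).
  have := cvgD D0 (cvg_linear_rV lL xu); rewrite add0r => H.
  apply: cvg_trans; last exact: H.
  by apply: near_eq_cvg; apply: nearW => i; rewrite !fctE subrK.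
apply/cvgr0Pnorm_le => d d0.
have B : \forall i \near F, `|(eps i)^-1 *: (x i - a)| <= `|u| + 1.
  have nu : `|(eps i)^-1 *: (x i - a)| @[i --> F] --> (`|u| : R) by exact: cvg_norm.
  move/cvgrPdist_le/(_ _ ltr01) : nu; apply: filterS => i.
  by move=> /ler_normlP[]; lra.
have d1 : 0 < d / (`|u| + 1) by rewrite divr_gt0 // ltr_wpDl.
have N : \forall i \near F, `|f (x i) - f a - L (x i - a)| <= d / (`|u| + 1) * `|x i - a|.
  exact: xa _ (fL _ d1).
apply: filterS2 B N => i Bi Ni.
rewrite (GRing.scalable_linear lL) -scalerBr normrZ.
apply: le_trans (ler_wpM2l (normr_ge0 _) Ni) _.
rewrite mulrCA -normrZ; apply: le_trans (ler_wpM2l (ltW d1) Bi) _.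
by rewrite divfK // lt0r_neq0 // ltr_wpDl.
Qed.

End LinearRow.

Section LieBracket.
Context (R : realType) (n : nat) (K : lieGroupType R n) (c : chart R n K).
Hypothesis hc : chart_at_1 c.

Notation e := (coord c 1%g).

(* Locked, since unification would otherwise unfold the limits inside [Ad] and
   [bracket]. Matrices act on row vectors, so products are reversed. *)
Fact adjoint_key : unit. Proof. exact: tt. Qed.
Definition AdM := locked_with adjoint_key (fun k => lin1_mx (Ad c k) : 'M[R]_n).
Definition adM := locked_with adjoint_key (fun v => lin1_mx (bracket c v) : 'M[R]_n).

Lemma mulAdM k w : w *m AdM k = Ad c k w.
Proof. by rewrite /AdM unlock; exact/mul_rV_linear/Ad_is_linear. Qed.

Lemma mx_ext (A B : 'M[R]_n) : (forall w : 'rV_n, w *m A = w *m B) -> A = B.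
Proof. by move=> H; apply/row_matrixP => i; rewrite !rowE. Qed.

Lemma AdM_mul k l : AdM (k * l)%g = AdM l *m AdM k.
Proof. by apply: mx_ext => w; rewrite mulmxA !mulAdM (Ad_mul hc). Qed.

Lemma AdM1 : AdM 1%g = 1%:M.
Proof. by apply: mx_ext => w; rewrite mulmx1 mulAdM (Ad_1 hc). Qed.

Lemma AdMV k : AdM k *m AdM k^-1%g = 1%:M.
Proof. by rewrite -AdM_mul mulVg AdM1. Qed.

Lemma AdVM k : AdM k^-1%g *m AdM k = 1%:M.
Proof. by rewrite -AdM_mul mulgV AdM1. Qed.

Lemma bracketE v w : bracket c v w = 'd (fun x => Ad c (param c x) w) e v.
Proof. by rewrite /bracket deriveE //; exact: Ad_param_differentiable. Qed.

Lemma bracket_linearl w : linear (fun v => bracket c v w).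
Proof. by move=> a u v; rewrite !bracketE linearP. Qed.

Lemma bracket_linear v : linear (bracket c v).
Proof.
move=> a u w; rewrite /bracket.
have dA z : derivable (fun x => Ad c (param c x) z) e v.
  exact/diff_derivable/Ad_param_differentiable.
have -> : (fun x => Ad c (param c x) (a *: u + w)) =
    a *: (fun x => Ad c (param c x) u) + (fun x => Ad c (param c x) w).
  by apply/funext => x; rewrite (Ad_is_linear hc).
by rewrite deriveD ?deriveZ //; exact: derivableZ.
Qed.

Lemma muladM v w : w *m adM v = bracket c v w.
Proof. by rewrite /adM unlock; exact/mul_rV_linear/bracket_linear. Qed.

Lemma adM_linear : linear adM.
Proof.
move=> a u v; apply: mx_ext => w.
rewrite [RHS]mulmxDr.
rewrite -(scalemxAr a w (adM u)).
rewrite (muladM u w) (muladM v w) (muladM (a *: u + v) w).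
exact: (bracket_linearl w a u v).
Qed.

Lemma adM_cvg T (F : set_system T) {FF : Filter F} (f : T -> 'rV[R]_n) u :
  f @ F --> u -> adM (f i) @[i --> F] --> adM u.
Proof. by move=> fu; apply: cvg_linear_rV => //; exact: adM_linear. Qed.

Lemma AdM_near (d : R) : 0 < d -> \forall x \near e,
  `|AdM (param c x) - 1%:M - adM (x - e)| <= d * `|x - e|.
Proof.
move=> d0.
have : \forall x \near e, forall i : 'I_n,
   `|Ad c (param c x) (delta_mx 0 i) - delta_mx 0 i - bracket c (x - e) (delta_mx 0 i)|
     <= d * `|x - e|.
  apply: (@filter_forall _ _ (fun i x =>
    `|Ad c (param c x) (delta_mx 0 i) - delta_mx 0 i - bracket c (x - e) (delta_mx 0 i)|
      <= d * `|x - e|) (nbhs e)) => i.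
  have := differentiable_near (Ad_param_differentiable hc (delta_mx 0 i)) d0.
  by apply: filterS => x; rewrite (param_coord1 hc) (Ad_1 hc) bracketE.
apply: filterS => x H; apply: mx_norm_leP => [|i j].
  by rewrite mulr_ge0 // ltW.
apply: le_trans (H i).
have -> : Ad c (param c x) (delta_mx 0 i) - delta_mx 0 i - bracket c (x - e) (delta_mx 0 i) =
    row i (AdM (param c x) - 1%:M - adM (x - e)).
  by rewrite rowE !mulmxBr mulmx1 mulAdM muladM.
by apply: le_trans (mx_norm_entry _ 0 j); rewrite [in leRHS]mxE.
Qed.

Lemma coord_cvg1 T (F : set_system T) {FF : Filter F} (q : T -> K) :
  q @ F --> (1%g : K) -> coord c (q i) @[i --> F] --> e.
Proof. by move=> q1; apply: (cvg_comp _ _ q1); exact: (coord_continuous hc.2). Qed.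

Lemma near_param_coord T (F : set_system T) {FF : Filter F} (q : T -> K) :
  q @ F --> (1%g : K) -> \forall i \near F, param c (coord c (q i)) = q i.
Proof.
move=> q1; have H : \forall i \near F, chart_dom c (q i) := q1 _ (chart_dom_near hc.2).
by apply: filterS H => i; exact: coordK.
Qed.

Lemma cvg_AdM_quot T (F : set_system T) {FF : Filter F} (q : T -> K) (eps : T -> R) (u : 'rV[R]_n) :
  q @ F --> (1%g : K) ->
  (eps i)^-1 *: (coord c (q i) - e) @[i --> F] --> u ->
  (eps i)^-1 *: (AdM (q i) - 1%:M) @[i --> F] --> adM u.
Proof.
move=> q1 qu.
have H : (eps i)^-1 *: (AdM (param c (coord c (q i))) - AdM (param c e)) @[i --> F] --> adM u.
  apply: (@cvg_diff_quot _ _ _ (fun x => AdM (param c x)) adM e T F FF eps (coord c \o q)) => //.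
  - exact: adM_linear.
  - by move=> d d0; rewrite (param_coord1 hc) AdM1; exact: AdM_near.
  - exact: coord_cvg1.
rewrite (param_coord1 hc) AdM1 in H.
apply: cvg_trans; last exact: H.
apply: near_eq_cvg.
have N0 : \forall i \near F, param c (coord c (q i)) = q i by exact: near_param_coord.
by apply: filterS N0 => i /= ->.
Qed.

End LieBracket.

Section AdjointCalculus.
Context (R : realType) (n : nat) (K : lieGroupType R n) (c : chart R n K).
Hypothesis hc : chart_at_1 c.

Notation e := (coord c 1%g).
Notation AdM := (AdM c).
Notation adM := (adM c).

Lemma param_line T (F : set_system T) {FF : Filter F} (eps : T -> R) (u : 'rV[R]_n) :
  eps @ F --> (0 : R) -> (\forall i \near F, eps i != 0) ->
  param c (e + eps i *: u) @[i --> F] --> (1%g : K) /\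
  (eps i)^-1 *: (coord c (param c (e + eps i *: u)) - e) @[i --> F] --> u.
Proof.
move=> eps0 epsn0.
have xe : e + eps i *: u @[i --> F] --> e.
  have := cvgD (@cvg_cst _ e _ F FF) (cvgZ eps0 (@cvg_cst _ u _ F FF)).
  by rewrite scale0r addr0 => H; exact: H.
split; first by apply: (cvg_comp _ _ xe); exact: param_cvg1.
have N : \forall i \near F, chart_cod c (e + eps i *: u) by exact: xe _ (near_chart_cod hc).
apply: cvg_near_cst; apply: filterS2 N epsn0 => i ci ei.
by rewrite paramK // addrC addKr scalerA mulVf // scale1r.
Qed.

Lemma cvg_conj_quot T (F : set_system T) {FF : Filter F} (q : T -> K) (eps : T -> R)
    (u : 'rV[R]_n) k :
  q @ F --> (1%g : K) -> (eps i)^-1 *: (coord c (q i) - e) @[i --> F] --> u ->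
  (k * q i * k^-1)%g @[i --> F] --> (1%g : K) /\
  (eps i)^-1 *: (coord c (k * q i * k^-1)%g - e) @[i --> F] --> Ad c k u.
Proof.
move=> q1 qu; split.
  have := cvg_mulg (cvg_mulg (@cvg_cst _ k _ F _) q1) (@cvg_cst _ (k^-1)%g _ F _).
  by rewrite mulg1 mulgV => H; exact: H.
pose f x := coord c (k * param c x * k^-1)%g.
have fe : f e = e by rewrite /f (param_coord1 hc) mulg1 mulgV.
have H : (eps i)^-1 *: (f (coord c (q i)) - f e) @[i --> F] --> Ad c k u.
  apply: (@cvg_diff_quot _ _ _ f (Ad c k) e T F FF eps (coord c \o q)) => //.
  - exact: Ad_is_linear.
  - move=> d d0; have := differentiable_near (conj_differentiable hc k) d0.
    by apply: filterS => y; rewrite (AdE hc).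
  - exact: coord_cvg1.
rewrite fe in H; apply: cvg_trans; last exact: H.
apply: near_eq_cvg.
have N0 : \forall i \near F, param c (coord c (q i)) = q i by exact: near_param_coord.
by apply: filterS N0 => i /= qi; rewrite /f qi.
Qed.

Lemma line_dnbhs (u : 'rV[R]_n) :
  param c (e + t *: u) @[t --> (0:R)^'] --> (1%g : K) /\
  t^-1 *: (coord c (param c (e + t *: u)) - e) @[t --> (0:R)^'] --> u.
Proof. by apply: param_line; [exact: cvg_within|exact: nbhs_dnbhs_neq]. Qed.

Lemma line_AdM (u : 'rV[R]_n) :
  t^-1 *: (AdM (param c (e + t *: u)) - 1%:M) @[t --> (0:R)^'] --> adM u.
Proof. by have [? ?] := line_dnbhs u; apply: cvg_AdM_quot. Qed.

(** The same difference quotient, that of [AdM] along the conjugated line, is computed in two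
    ways. *)
Lemma adM_Ad k v : adM (Ad c k v) = AdM k^-1%g *m adM v *m AdM k.
Proof.
have [q1 qv] := line_dnbhs v.
have [kq1 kqv] := cvg_conj_quot k q1 qv.
have H1 : t^-1 *: (AdM (k * param c (e + t *: v) * k^-1)%g - 1%:M) @[t --> (0:R)^'] -->
    adM (Ad c k v) by exact: cvg_AdM_quot.
have H2 : AdM k^-1%g *m (t^-1 *: (AdM (param c (e + t *: v)) - 1%:M)) *m AdM k
    @[t --> (0:R)^'] --> AdM k^-1%g *m adM v *m AdM k.
  by do 2?apply: cvg_mulmx; try exact: cvg_cst; exact: line_AdM.
apply: (cvg_unique (@norm_hausdorff _ _) H1).
apply: cvg_trans; last exact: H2.
apply: near_eq_cvg; apply: nearW => t /=.
rewrite -scalemxAr -scalemxAl; congr (_ *: _).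
by rewrite mulmxBr mulmxBl mulmx1 (AdVM hc) !(AdM_mul hc) mulmxA.
Qed.

Lemma AdM_cvg1 T (F : set_system T) {FF : Filter F} (q : T -> K) :
  q @ F --> (1%g : K) -> AdM (q i) @[i --> F] --> (1%:M : 'M[R]_n).
Proof.
move=> q1; apply/cvg_mxP => i j.
have N0 : \forall i \near F, param c (coord c (q i)) = q i by exact: near_param_coord.
have /cvg_mxP/(_ 0 j) : Ad c (param c (coord c (q x))) (delta_mx 0 i) @[x --> F] -->
    (delta_mx 0 i : 'rV[R]_n).
  have H : Ad c (param c x) (delta_mx 0 i) @[x --> e] --> Ad c (param c e) (delta_mx 0 i).
    exact: differentiable_continuous (Ad_param_differentiable hc (delta_mx 0 i)).
  rewrite (param_coord1 hc) (Ad_1 hc) in H.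
  exact: (cvg_comp _ _ (coord_cvg1 hc q1) H).
have -> : (1%:M : 'M[R]_n) i j = (delta_mx 0 i : 'rV[R]_n) 0 j.
  by rewrite !mxE eqxx eq_sym.
apply: cvg_trans; apply: near_eq_cvg.
apply: filterS N0 => x ->.
by rewrite -(mulAdM hc) -rowE mxE.
Qed.

Lemma AdM_continuous : continuous (AdM : K -> 'M[R]_n).
Proof.
move=> k.
have kq : (k^-1 * l)%g @[l --> k] --> (1%g : K).
  rewrite -(mulVg k); apply: cvg_mulg => //; exact: cvg_cst.
have H := cvg_mulmx (AdM_cvg1 kq) (@cvg_cst _ (AdM k) _ (nbhs k) _).
rewrite mul1mx in H; apply: cvg_trans; last exact: H.
apply: near_eq_cvg; apply: nearW => l /=.
by rewrite -(AdM_mul hc) mulVKg.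
Qed.

(** The Jacobi identity, obtained by differentiating [adM v *m AdM q = AdM q *m adM (Ad c q v)] at
    [q = 1] in the direction [u]; the product rule suffices. *)
Lemma adM_bracket u v : adM (bracket c u v) = adM v *m adM u - adM u *m adM v.
Proof.
pose q t := param c (e + t *: u).
have [q1 _] := line_dnbhs u; rewrite -/(q _) in q1.
have Hu : t^-1 *: (AdM (q t) - 1%:M) @[t --> (0:R)^'] --> adM u := @line_AdM u.
have lad := adM_linear hc.
have adZ := GRing.scalable_linear lad.
have adB := GRing.zmod_morphism_linear lad.
have H1 : t^-1 *: (adM (Ad c (q t) v) - adM v) @[t --> (0:R)^'] --> adM (bracket c u v).
  have HB : adM (v *m (t^-1 *: (AdM (q t) - 1%:M))) @[t --> (0:R)^'] --> adM (v *m adM u).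
    by apply: adM_cvg => //; apply: cvg_mulmx => //; exact: cvg_cst.
  rewrite (muladM hc) in HB; apply: cvg_trans; last exact: HB.
  apply: near_eq_cvg; apply: nearW => t /=.
  by rewrite -scalemxAr mulmxBr mulmx1 (mulAdM hc) adZ adB.
have H2 : adM (Ad c (q t) v) @[t --> (0:R)^'] --> adM v.
  apply: adM_cvg => //.
  have HB : v *m AdM (q t) @[t --> (0:R)^'] --> v *m 1%:M.
    by apply: cvg_mulmx; [exact: cvg_cst|exact: AdM_cvg1].
  rewrite mulmx1 in HB; apply: cvg_trans; last exact: HB.
  by apply: near_eq_cvg; apply: nearW => t /=; rewrite (mulAdM hc).
have HL : adM v *m (t^-1 *: (AdM (q t) - 1%:M)) @[t --> (0:R)^'] --> adM v *m adM u.
  by apply: cvg_mulmx => //; exact: cvg_cst.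
have HR : t^-1 *: (AdM (q t) - 1%:M) *m adM (Ad c (q t) v) +
    t^-1 *: (adM (Ad c (q t) v) - adM v) @[t --> (0:R)^'] -->
    adM u *m adM v + adM (bracket c u v).
  by apply: cvgD => //; exact: cvg_mulmx.
suff -> : adM v *m adM u = adM u *m adM v + adM (bracket c u v) by rewrite addrC addKr.
apply: (cvg_unique (@norm_hausdorff _ _) HL).
apply: cvg_trans; last exact: HR.
apply: near_eq_cvg; apply: nearW => t /=.
rewrite -scalemxAl -scalerDr -scalemxAr; congr (_ *: _).
rewrite mulmxBl mulmxBr mulmx1 mul1mx addrA subrK; congr (_ - _).
by rewrite adM_Ad !mulmxA (AdMV hc) mul1mx.
Qed.

End AdjointCalculus.

(** * Powers and the adjoint representation *)

Section IntegerPower.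
Context (G : groupType).
Implicit Types (k : G) (z : int).

Definition zexpg k z : G :=
  if z is Negz m then (k ^- m.+1)%g else (k ^+ `|z|%N)%g.

Lemma zexpg_nat k m : zexpg k m%:Z = (k ^+ m)%g. Proof. by []. Qed.

Lemma zexpg_abs k z : zexpg k z = (if 0 <= z then k ^+ `|z|%N else k ^- `|z|%N)%g.
Proof. by case: z. Qed.

Lemma zexpgS k z : zexpg k (z + 1) = (zexpg k z * k)%g.
Proof.
case: z => [m|[|m]]; first by rewrite -PoszD addn1 !zexpg_nat expgSr.
  by rewrite /= expg1 mulVg.
have -> : Negz m.+1 + 1 = Negz m by rewrite !NegzE -[m.+2]addn1 PoszD opprD subrK.
by rewrite /= [(k ^+ m.+2)%g]expgS invgM mulgVK.
Qed.

Lemma zexpgB1 k z : zexpg k (z - 1) = (zexpg k z * k^-1)%g.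
Proof. by rewrite -{2}(subrK 1 z) zexpgS mulgK. Qed.

Lemma zexpgD k y z : zexpg k (y + z) = (zexpg k y * zexpg k z)%g.
Proof.
elim: z => [|m IH|m IH]; first by rewrite addr0 /= mulg1.
  by rewrite -addn1 PoszD addrA !zexpgS IH mulgA.
by rewrite -addn1 PoszD opprD addrA !zexpgB1 IH mulgA.
Qed.
End IntegerPower.

(** The defect of additivity of the floor is 0 or 1, so it costs at most one extra factor [q i] in a
    product of powers, and that factor tends to 1. *)
Lemma floorD_nat (R : realType) (x y : R) :
  exists b : bool, Num.floor (x + y) = Num.floor x + Num.floor y + b%:Z.
Proof.
have /andP[x1 x2] := floor_itv x; have /andP[y1 y2] := floor_itv y.
rewrite !intrD mulr1z in x2 y2.
case: (lerP ((Num.floor x)%:~R + (Num.floor y)%:~R + 1) (x + y)) => h;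
  [exists true|exists false]; apply: floor_def;
  by rewrite !intrD ?mulr1z ?mulr0z; apply/andP; split; lra.
Qed.

Section CompactSemisimple.
Context (R : realType) (n : nat) (K : lieGroupType R n) (c : chart R n K).
Hypotheses (hc : chart_at_1 c) (hK : compact [set: K]) (hss : semisimple c).

Notation e := (coord c 1%g).
Notation AdM := (AdM c).
Notation adM := (adM c).

(* The kernel of [ad] is an abelian ideal. *)
Lemma adM_inj v : adM v = 0 -> v = 0.
Proof.
have lad := adM_linear hc.
pose adL := GRing.isLinear.Build _ _ _ _ _ lad.
pose ad : {linear 'rV[R]_n -> 'M[R]_n} := HB.pack adM adL.
have memI w : (w \in lker (linfun ad)) = (adM w == 0) by rewrite memv_ker lfunE.
have I0 : lker (linfun ad) = 0%VS.
  apply: hss => [u w|u w]; rewrite !memI.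
    by move=> /eqP w0; rewrite (adM_bracket hc) w0 mul0mx mulmx0 subrr.
  by move=> /eqP u0 _; rewrite -(muladM hc) u0 mulmx0.
by move=> v0; apply/eqP; rewrite -memv0 -I0 memI v0.
Qed.

(** The injective map [adM] has a right inverse in matrix form, whose norm gives the constant; the
    [+ 1] in [b] keeps it positive. *)
Lemma adM_lower : exists2 a : R, 0 < a & forall x, a * `|x| <= `|adM x|.
Proof.
have lad := adM_linear hc.
have lf : linear (mxvec \o adM) by move=> a u v; rewrite /= lad linearP.
pose G := lin1_mx (mxvec \o adM).
have GE x : x *m G = mxvec (adM x) by exact: mul_rV_linear.
have fG : row_free G.
  apply: inj_row_free => v; rewrite GE => /eqP.
  by rewrite mxvec_eq0 => /eqP; exact: adM_inj.
pose H := pinvmx G.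
pose b := (n * n)%:R * `|H| + 1.
have b0 : 0 < b by rewrite ltr_wpDl // mulr_ge0.
exists b^-1; first by rewrite invr_gt0.
move=> x; rewrite ler_pdivrMl //.
rewrite -{1}(mulmx1 x) -(mulmxVp fG) mulmxA GE.
apply: le_trans (mx_normM _ _) _.
rewrite mulrAC; apply: ler_pM; rewrite ?mulr_ge0 ?mxvec_norm //.
by rewrite lerDl.
Qed.

(** Half of the constant for [adM] absorbs the first-order error of [AdM_near]. *)
Lemma AdM_lower : exists2 a : R, 0 < a &
  \forall x \near e, a * `|x - e| <= `|AdM (param c x) - 1%:M|.
Proof.
have [a a0 Ha] := adM_lower.
have a2 : 0 < a / 2 by rewrite divr_gt0.
exists (a / 2) => //.
apply: filterS (AdM_near hc a2) => x H.
have E : adM (x - e) = (AdM (param c x) - 1%:M) - (AdM (param c x) - 1%:M - adM (x - e)).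
  by rewrite subKr.
have := ler_normB (AdM (param c x) - 1%:M) (AdM (param c x) - 1%:M - adM (x - e)).
by rewrite -E; have := Ha (x - e); lra.
Qed.

Lemma AdM_bounded : exists2 C : R, 0 < C & forall k, `|AdM k| <= C.
Proof.
have cf : {within [set: K], continuous (fun k => `|AdM k|)}.
  apply: continuous_subspaceT => k; apply: cvg_norm; exact: AdM_continuous.
have [k _ H] := compact_EVT_max (ex_intro _ 1%g I) hK cf.
exists (`|AdM k| + 1) => [|l]; first by rewrite ltr_wpDl.
by apply: le_trans (H l _) _; rewrite ?inE // lerDl.
Qed.

(** The bound on all [AdM k] prevents exponential growth: each step multiplies an increment by a
    bounded matrix, so the errors add up to a linear and a quadratic term in [m * |AdM k - 1|]. *)
Lemma AdM_expg (C : R) k m : 0 < C -> (forall k, n%:R * `|AdM k| <= C) ->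
  `|AdM (k ^+ m)%g - 1%:M| <= C * m%:R * `|AdM k - 1%:M| /\
  `|AdM (k ^+ m)%g - 1%:M - m%:R *: (AdM k - 1%:M)| <= 
     n%:R * C * (m%:R * `|AdM k - 1%:M|) ^+ 2.
Proof.
move=> C0 HC; set l := `|AdM k - 1%:M|.
have l0 : 0 <= l by exact: normr_ge0.
elim: m => [|m [IH1 IH2]].
  rewrite expg0 (AdM1 hc) subrr normr0 scale0r subrr normr0.
  by rewrite !(mulr0, mul0r) expr0n mulr0.
have E : AdM (k ^+ m.+1)%g - 1%:M =
   (AdM k - 1%:M) *m AdM (k ^+ m)%g + (AdM (k ^+ m)%g - 1%:M).
  by rewrite expgSr (AdM_mul hc) mulmxBl mul1mx addrA subrK.
split.
  rewrite E; apply: le_trans (ler_normD _ _) _.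
  have -> : C * m.+1%:R * l = l * C + C * m%:R * l by rewrite -natr1; ring.
  apply: lerD => //; apply: le_trans (mx_normM _ _) _; rewrite mulrAC -/l mulrC.
  by rewrite ler_wpM2l.
have -> : AdM (k ^+ m.+1)%g - 1%:M - m.+1%:R *: (AdM k - 1%:M) =
   (AdM k - 1%:M) *m (AdM (k ^+ m)%g - 1%:M) +
   (AdM (k ^+ m)%g - 1%:M - m%:R *: (AdM k - 1%:M)).
  rewrite mulmxBr mulmx1 -natr1 scalerDl scale1r.
  by rewrite E [_ *: _ + _]addrC opprD addrACA.
apply: le_trans (ler_normD _ _) _.
have H1 : `|(AdM k - 1%:M) *m (AdM (k ^+ m)%g - 1%:M)| <= n%:R * l * (C * m%:R * l).
  by apply: le_trans (mx_normM _ _) _; rewrite ler_wpM2l ?mulr_ge0.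
apply: le_trans (lerD H1 IH2) _.
rewrite -natr1 -subr_ge0.
have -> : n%:R * C * ((m%:R + 1) * l) ^+ 2 -
  (n%:R * l * (C * m%:R * l) + n%:R * C * (m%:R * l) ^+ 2) =
  n%:R * C * l ^+ 2 * (m%:R + 1) :> R by ring.
by rewrite !mulr_ge0 ?exprn_ge0 ?addr_ge0 // ltW.
Qed.

Lemma AdM_zexpg : exists2 C : R, 0 < C & forall k z,
  `|AdM (zexpg k z) - 1%:M| <= C * `|z%:~R| * `|AdM k - 1%:M| /\
  `|AdM (zexpg k z) - 1%:M - z%:~R *: (AdM k - 1%:M)| <=
     C * (`|z%:~R| * `|AdM k - 1%:M|) ^+ 2.
Proof.
have [C0 C00 HC0] := AdM_bounded.
pose C := n%:R * C0 + 1.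
have C_gt0 : 0 < C by rewrite ltr_wpDl // mulr_ge0 // ltW.
have HC k : n%:R * `|AdM k| <= C.
  by apply: ler_wpDr => //; rewrite ler_wpM2l.
pose D := n%:R * C + n%:R * C * C ^+ 2.
have nR0 : 0 <= n%:R :> R by [].
have D0 : 0 <= D by rewrite addr_ge0 ?mulr_ge0 ?exprn_ge0 // ltW.
have C2 : 0 <= C ^+ 2 by rewrite exprn_ge0 // ltW.
exists (C + C ^+ 2 + D) => [|k z]; first by rewrite ltr_wpDr // ltr_wpDr.
set l := `|AdM k - 1%:M|; have l0 : 0 <= l by exact: normr_ge0.
have [H1 H2] := AdM_expg k `|z| C_gt0 HC; rewrite -/l in H1 H2.
have -> : `|z%:~R| = `|z|%N%:R :> R by rewrite natr_absz intr_norm.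
set m : R := `|z|%N%:R in H1 H2 *; have m0 : 0 <= m by rewrite ler0n.
have ml0 : 0 <= m * l by rewrite mulr_ge0.
have ml2 : 0 <= (m * l) ^+ 2 by rewrite exprn_ge0.
rewrite zexpg_abs; case: (lerP 0 z) => z0.
  have -> : z%:~R = m by rewrite /m natr_absz ger0_norm.
  split; first apply: le_trans H1 _.
    by rewrite -!mulrA ler_wpM2r // -addrA lerDl addr_ge0.
  apply: le_trans H2 _; rewrite ler_wpM2r // /D.
  have := mulr_ge0 (mulr_ge0 nR0 (ltW C_gt0)) C2; move: C2 C_gt0.
  by generalize (C ^+ 2) => X; lra.
have -> : z%:~R = - m by rewrite /m natr_absz ltr0_norm // mulrNz opprK.
set A := AdM (k ^+ `|z|)%g in H1 H2.
set B := AdM (k ^- `|z|)%g.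
have AB : A *m B = 1%:M by exact: AdMV.
have E1 : B - 1%:M = - ((A - 1%:M) *m B) by rewrite mulmxBl AB mul1mx opprB.
have HB : `|B - 1%:M| <= C * `|A - 1%:M|.
  rewrite E1 normrN; apply: le_trans (mx_normM _ _) _.
  by rewrite mulrAC ler_wpM2r // HC.
have HB2 : `|B - 1%:M| <= C ^+ 2 * m * l.
  apply: le_trans HB _; apply: le_trans (ler_wpM2l (ltW C_gt0) H1) _.
  by rewrite expr2 !mulrA.
split; first apply: le_trans HB2 _.
  rewrite -(mulrA _ m l) -(mulrA _ m l) ler_wpM2r //.
  by move: C_gt0 D0; lra.
(* Since [A *m B = 1], the increment of the inverse is minus that of [A] up to the product of the
   two increments, which is already quadratic. *)
have -> : B - 1%:M - - m *: (AdM k - 1%:M) =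
  - (A - 1%:M - m *: (AdM k - 1%:M)) - (A - 1%:M) *m (B - 1%:M).
  have -> : (A - 1%:M) *m (B - 1%:M) = - (A - 1%:M) - (B - 1%:M).
    by rewrite mulmxBl mulmxBr AB mulmx1 mul1mx (opprB A).
  by rewrite scaleNr opprK (opprB (A - 1%:M)) (opprD (- (A - 1%:M))) !opprK addrA subrK addrC.
apply: le_trans (ler_normB _ _) _; rewrite normrN.
have H3 : `|(A - 1%:M) *m (B - 1%:M)| <= n%:R * (C * m * l) * (C ^+ 2 * m * l).
  apply: le_trans (mx_normM _ _) _.
  by rewrite ler_pM ?mulr_ge0 // ler_wpM2l.
apply: le_trans (lerD H2 H3) _.
have -> : n%:R * C * (m * l) ^+ 2 + n%:R * (C * m * l) * (C ^+ 2 * m * l) =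
   D * (m * l) ^+ 2 by rewrite /D; ring.
by rewrite ler_wpM2r // lerDr addr_ge0 // ltW.
Qed.

End CompactSemisimple.

(** * One-parameter subgroups as ultralimits *)

Lemma ler_cvg_filter (R : realType) T (F : set_system T) {FF : ProperFilter F}
    (f g : T -> R) (a b : R) :
  f @ F --> a -> g @ F --> b -> (\forall x \near F, f x <= g x) -> a <= b.
Proof.
move=> fa gb fg; rewrite -subr_ge0; apply: (cvgr_to_ge (cvgB gb fa)).
by apply: filterS fg => x; rewrite subr_ge0.
Qed.

Lemma near_norm_le (R : realType) (V : normedModType R) (a : V) (P : V -> Prop) :
  (\forall x \near a, P x) -> exists2 r : R, 0 < r & forall x, `|x - a| <= r -> P x.
Proof.
move=> /nbhs_normP[r /= r0 rP]; exists (r / 2); first by rewrite divr_gt0.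
move=> x xa; apply: rP; rewrite /= distrC (le_lt_trans xa) //.
by rewrite ltr_pdivrMr // ltr_pMr // ltr1n.
Qed.

Lemma is_derive_cvg (R : realType) (V : normedModType R) (f : R -> V) v :
  is_derive (0 : R) (1 : R) f v <-> t^-1 *: (f t - f 0) @[t --> (0 : R)^'] --> v.
Proof.
have E : (fun h => h^-1 *: ((f \o shift 0) (h *: (1 : R)) - f 0)) =
    (fun t => t^-1 *: (f t - f 0)).
  by apply/funext => t; rewrite /= addr0 /GRing.scale /= mulr1.
split=> [[]|H].
  by rewrite /derivable /derive E => D <-.
by split; rewrite /derivable /derive E; [exact: cvgP H|exact: cvg_lim H].
Qed.

Section OneParameter.
Context (R : realType) (n : nat) (K : lieGroupType R n) (c : chart R n K).
Hypotheses (hc : chart_at_1 c) (hK : compact [set: K]) (hss : semisimple c).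

Notation e := (coord c 1%g).
Notation AdM := (AdM c).
Notation adM := (adM c).

(** A small [AdM k - 1] says nothing about an element far from 1, so the powers must be followed one
    at a time. While [x ^+ m] is within [r0] of 1 it lies in [V], so [x ^+ m.+1] lies where [AdM]
    controls the coordinates; the hypothesis on [AdM] then renews the bound. *)
Lemma coord_expg : exists C r0 : R, exists V : set K, [/\ 0 < C, 0 < r0, nbhs (1%g : K) V &
  forall (x : K) (l : R), V x -> 0 <= l ->
   (forall m, `|AdM (x ^+ m)%g - 1%:M| <= m%:R * l) -> forall m, C * (m%:R * l) <= r0 ->
   chart_dom c (x ^+ m)%g /\ `|coord c (x ^+ m)%g - e| <= C * (m%:R * l)].
Proof.
have [a a0 Ha] := AdM_lower hc hss.
pose U k := chart_dom c k /\ a * `|coord c k - e| <= `|AdM k - 1%:M|.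
have U1 : \forall k \near (1%g : K), U k.
  have cc : coord c k @[k --> (1%g : K)] --> e by exact: (coord_cvg1 hc).
  have H : \forall k \near (1%g : K), a * `|coord c k - e| <= `|AdM (param c (coord c k)) - 1%:M|.
    exact: cc _ Ha.
  apply: filterS2 (chart_dom_near hc.2) H => k dk; rewrite coordK //.
have [[A B] /= [A1 B1] AB] : nbhs ((1%g, 1%g) : K * K) (fun z => U (z.1 * z.2)%g).
  by apply: (@lie_mul_continuous R n K (1%g, 1%g)); rewrite /= mulg1.
pose V := A `&` B.
have V1 : nbhs (1%g : K) V by exact: filterI.
have [r0 r0_gt0 Hr0] := near_norm_le (param_cvg1 hc V1).
exists a^-1, r0, V; split => //; first by rewrite invr_gt0.
move=> x l Vx l0 Hx; elim=> [|m IH] Cm.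
  by rewrite expg0 subrr normr0 !mul0r mulr0; split => //; exact: hc.2.
have Cm' : a^-1 * (m%:R * l) <= r0.
  apply: le_trans Cm; rewrite ler_pM2l ?invr_gt0 //.
  by rewrite ler_wpM2r // ler_nat.
have [dm xm] := IH Cm'.
have Vm : V (x ^+ m)%g.
  by rewrite -(coordK dm); apply: Hr0; apply: le_trans xm Cm'.
have [/= dm1 lm1] : U (x ^+ m.+1)%g.
  by rewrite expgSr; apply: (AB (_, _)); split; [exact: Vm.1|exact: Vx.2].
by split => //; rewrite ler_pdivlMl //; apply: le_trans lm1 _; exact: Hx.
Qed.

(** Limits could leave the open chart domain. A closed ball inside [chart_cod] rules this out: the
    coordinates converge in it, and uniqueness of limits in [K] identifies [k] with the point they
    describe. *)
Lemma coord_limit : exists2 r1 : R, 0 < r1 & forall I (F : set_system I) (FF : UltraFilter F)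
  (f : I -> K) (k : K) r, r <= r1 ->
  (\forall i \near F, chart_dom c (f i) /\ `|coord c (f i) - e| <= r) ->
  f @ F --> k -> chart_dom c k /\ `|coord c k - e| <= r.
Proof.
have [r1 r10 H1] := near_norm_le (near_chart_cod hc).
exists r1 => // I F FF f k r rr1 Hf fk.
have [x Hx] : exists x : 'rV[R]_n, coord c (f i) @[i --> F] --> x.
  apply: (@ultra_bounded_cvg _ _ _ _ _ _ _ (r + `|e|)).
  apply: filterS Hf => i [_ H]; rewrite -[X in `|X|](subrK e).
  by apply: le_trans (ler_normD _ _) _; rewrite lerD2r.
have xr : `|x - e| <= r.
  have nx : `|coord c (f i) - e| @[i --> F] --> `|x - e|.
    by apply: cvg_norm; apply: cvgB => //; exact: cvg_cst.
  by apply: cvgr_to_le nx _; apply: filterS Hf => i [].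
have cx : chart_cod c x by apply: H1; apply: le_trans rr1.
have px : f @ F --> param c x.
  have H : param c (coord c (f i)) @[i --> F] --> param c x.
    by apply: (cvg_comp _ _ Hx); exact: param_continuous.
  apply: cvg_trans; last exact: H.
  by apply: near_eq_cvg; apply: filterS Hf => i [di _]; rewrite coordK.
have -> : k = param c x by apply: (cvg_unique (lie_hausdorff (s := K)) fk px).
by split; [exact: param_dom|rewrite paramK].
Qed.

Section Limit.
Variables (I : Type) (F : set_system I) (FF : UltraFilter F).
Variables (q : I -> K) (eps : I -> R) (u : 'rV[R]_n).
Hypotheses (eps_gt0 : forall i, 0 < eps i) (eps0 : eps @ F --> (0 : R)).
Hypotheses (q1 : q @ F --> (1%g : K)).
Hypothesis qu : (eps i)^-1 *: (coord c (q i) - e) @[i --> F] --> u.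

Let quot : (eps i)^-1 *: (AdM (q i) - 1%:M) @[i --> F] --> adM u.
Proof. exact: cvg_AdM_quot. Qed.

Let norm_cvg (z : I -> int) (s : R) : (z i)%:~R * eps i @[i --> F] --> s ->
  `|(z i)%:~R| * `|AdM (q i) - 1%:M| @[i --> F] --> `|s| * `|adM u|.
Proof.
move=> zs.
have H : `|(z i)%:~R * eps i| * `|(eps i)^-1 *: (AdM (q i) - 1%:M)| @[i --> F] --> `|s| * `|adM u|.
  by apply: cvgM; exact: cvg_norm.
apply: cvg_trans; last exact: H.
apply: near_eq_cvg; apply: nearW => i /=.
rewrite normrM normrZ normfV mulrA mulfK //.
by rewrite normr_eq0 gt_eqF.
Qed.

(** This gives the limit one-parameter group its continuity at 0 and keeps it in the chart for small
    times. *)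
Lemma limit_near : exists C t0 : R, [/\ 0 < C, 0 < t0 &
  forall (z : I -> int) (s : R) (k : K), (z i)%:~R * eps i @[i --> F] --> s ->
   zexpg (q i) (z i) @[i --> F] --> k -> `|s| <= t0 ->
   chart_dom c k /\ `|coord c k - e| <= C * `|s|].
Proof.
have [C1 C10 HC1] := AdM_zexpg hc hK.
have [C [r0 [V [C0 r00 V1 HV]]]] := coord_expg.
have [r1 r10 Hr1] := coord_limit.
pose M := C * C1 * `|adM u|.
have M0 : 0 <= M by rewrite !mulr_ge0 // ltW.
pose r := Num.min r0 r1.
have r_gt0 : 0 < r by rewrite lt_min r00.
(* The [+ 1] secures positivity, and the factor 1/2 makes [M * |s|] strictly smaller than [r], the
   room required by [main]. *)
exists (M + 1), (r / (M + 1) / 2); split; [by rewrite ltr_wpDl|by rewrite !divr_gt0 // ltr_wpDl|].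
move=> z s k zs zk s0.
have M1 : 0 < M + 1 by rewrite ltr_wpDl.
have s1 : M * `|s| < r.
  have s2 : (M + 1) * `|s| <= r / 2.
    rewrite mulrC -ler_pdivlMr //; apply: le_trans s0 _.
    by rewrite -!mulrA [_^-1 * _]mulrC.
  have : M * `|s| <= (M + 1) * `|s| by rewrite ler_wpM2r // lerDl.
  by move: s2 r_gt0; lra.
have cv : C * (`|(z i)%:~R| * (C1 * `|AdM (q i) - 1%:M|)) @[i --> F] --> M * `|s|.
  have H : C * C1 * (`|(z i)%:~R| * `|AdM (q i) - 1%:M|) @[i --> F] --> C * C1 * (`|s| * `|adM u|).
    by apply: cvgM; [exact: cvg_cst|exact: norm_cvg].
  have -> : M * `|s| = C * C1 * (`|s| * `|adM u|) by rewrite /M; ring.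
  apply: cvg_trans; last exact: H.
  by apply: near_eq_cvg; apply: nearW => i; ring.
have qV : \forall i \near F, V (q i) by exact: q1 _ V1.
have qV' : \forall i \near F, V (q i)^-1%g.
  have q1' : (q i)^-1%g @[i --> F] --> (1^-1%g : K) by exact: cvg_invg.
  by apply: q1'; rewrite invg1.
(* Convergence bounds the approximants only by radii strictly above the limit [M * |s|]; the radius
   is lowered to [M * |s|] at the end. *)
have main (r' : R) : M * `|s| < r' -> r' <= r -> chart_dom c k /\ `|coord c k - e| <= r'.
  move=> Mr' r'r.
  apply: (Hr1 I F FF (fun i => zexpg (q i) (z i))) => //.
    by apply: le_trans r'r _; rewrite ge_min lexx orbT.
  have near_r : \forall i \near F, C * (`|(z i)%:~R| * (C1 * `|AdM (q i) - 1%:M|)) <= r'.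
    by apply: cvgr_le cv _ Mr'.
  apply: filterS3 qV qV' near_r => i Vq Vq' zr.
  have H (x : K) : V x -> (forall m, `|AdM (x ^+ m)%g - 1%:M| <= m%:R * (C1 * `|AdM (q i) - 1%:M|)) ->
    chart_dom c (x ^+ `|z i|)%g /\ `|coord c (x ^+ `|z i|)%g - e| <= r'.
    move=> Vx Hx.
    have l0 : 0 <= C1 * `|AdM (q i) - 1%:M| by rewrite mulr_ge0 // ltW.
    have Hz : C * (`|z i|%N%:R * (C1 * `|AdM (q i) - 1%:M|)) <= r'.
      by rewrite natr_absz intr_norm.
    have := HV x _ Vx l0 Hx `|z i|%N.
    case=> [|? Hc]; first by apply: le_trans Hz (le_trans r'r _); rewrite ge_min lexx.
    by split => //; apply: le_trans Hc Hz.
  rewrite zexpg_abs; case: ifP => _.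
    apply: H => // m; have [] := HC1 (q i) m; rewrite zexpg_nat => H _.
    by apply: le_trans H _; rewrite ger0_norm ?ler0z // mulrCA mulrA.
  rewrite -expVgn; apply: H => // m.
  have [] := HC1 (q i) (- m%:Z).
  have -> : zexpg (q i) (- m%:Z) = ((q i)^-1 ^+ m)%g.
    by rewrite expVgn; case: m => [|m] //=; rewrite invg1.
  move=> H _; apply: le_trans H _.
  by rewrite mulrNz normrN ger0_norm ?ler0z // mulrCA mulrA.
have [dk _] := main _ s1 (lexx _); split => //.
apply: le_trans (_ : _ <= M * `|s|) _; last by rewrite ler_wpM2r // lerDl.
apply/ler_addgt0Pr => d d0.
have [|le_r] := lerP (M * `|s| + d) r.
  by move=> le_r; apply: (main _ _ le_r).2; rewrite ltrDl.
by apply: le_trans (main _ s1 (lexx _)).2 (ltW le_r).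
Qed.

(** The expansion [Ad = 1 + s ad_u + O(s^2)] passes to the limit because the quadratic estimate for
    powers is uniform. *)
Lemma limit_est : exists2 C : R, 0 <= C &
  forall (z : I -> int) (s : R) (k : K), (z i)%:~R * eps i @[i --> F] --> s ->
   zexpg (q i) (z i) @[i --> F] --> k ->
   `|AdM k - 1%:M - s *: adM u| <= C * s ^+ 2.
Proof.
have [C C0 HC] := AdM_zexpg hc hK.
exists (C * `|adM u| ^+ 2) => [|z s k zs zk].
  by rewrite mulr_ge0 ?exprn_ge0 // ltW.
have H1 : `|AdM (zexpg (q i) (z i)) - 1%:M - (z i)%:~R *: (AdM (q i) - 1%:M)|
    @[i --> F] --> `|AdM k - 1%:M - s *: adM u|.
  apply: cvg_norm; apply: cvgB.
    apply: cvgB; last exact: cvg_cst.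
    by apply: (cvg_comp _ _ zk); exact: AdM_continuous.
  have H := cvgZ zs quot.
  apply: cvg_trans; last exact: H.
  apply: near_eq_cvg; apply: nearW => i /=.
  by rewrite scalerA mulfK // gt_eqF.
have H2 : C * (`|(z i)%:~R| * `|AdM (q i) - 1%:M|) ^+ 2 @[i --> F] --> C * (`|s| * `|adM u|) ^+ 2.
  apply: cvgM; first exact: cvg_cst.
  by rewrite expr2; under eq_fun do rewrite expr2; apply: cvgM; exact: norm_cvg.
have -> : C * `|adM u| ^+ 2 * s ^+ 2 = C * (`|s| * `|adM u|) ^+ 2.
  by rewrite exprMn -normrX (ger0_norm (sqr_ge0 s)); ring.
apply: (ler_cvg_filter H1 H2).
by apply: nearW => i; have [] := HC (q i) (z i).
Qed.

End Limit.
End OneParameter.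

Section OneParameterExistence.
Context (R : realType) (n : nat) (K : lieGroupType R n) (c : chart R n K).
Hypotheses (hc : chart_at_1 c) (hK : compact [set: K]) (hss : semisimple c).

Notation e := (coord c 1%g).
Notation AdM := (AdM c).
Notation adM := (adM c).

Lemma subgroup_zexpg (T : set K) k z : subgroup T -> T k -> T (zexpg k z).
Proof.
move=> [T1 TM TV] Tk.
have TX m : T (k ^+ m)%g.
  by elim: m => [|m IH]; [rewrite expg0|rewrite expgS; exact: TM].
by rewrite zexpg_abs; case: ifP => _ //; exact: TV.
Qed.

Lemma one_param_of_local (g : R -> K) : (forall s t, g (s + t) = (g s * g t)%g) ->
  g t @[t --> (0 : R)] --> (1%g : K) -> one_param_subgroup g.
Proof.
move=> gD g0; split => // s.
have H : (g s * g (t - s))%g @[t --> s] --> (g s * 1)%g.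
  apply: cvg_mulg; first exact: cvg_cst.
  have cs : t - s @[t --> s] --> (0 : R).
    have := @cvgB _ _ _ (nbhs s) _ id (cst s) s s cvg_id (@cvg_cst _ s _ (nbhs s) _).
    by rewrite subrr => H; exact: H.
  exact: (cvg_comp _ _ cs g0).
rewrite mulg1 in H; apply: cvg_trans; last exact: H.
by apply: near_eq_cvg; apply: nearW => t /=; rewrite -gD addrC subrK.
Qed.

(** The velocity is found through [Ad]: with [y] the coordinate displacement of [g t], both [t ad_u]
    and [ad_y] approximate [AdM (g t) - 1], and the lower bound for [adM] turns their closeness into
    closeness of [y] and [t u]. *)
Lemma lie_subalgebra_limit (T : set K) I (F : set_system I) (FF : UltraFilter F)
    (q : I -> K) (eps : I -> R) (u : 'rV[R]_n) :
  compact T -> subgroup T -> (forall i, T (q i)) -> (forall i, 0 < eps i) ->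
  eps @ F --> (0 : R) -> q @ F --> (1%g : K) ->
  (eps i)^-1 *: (coord c (q i) - e) @[i --> F] --> u ->
  lie_subalgebra c T u.
Proof.
move=> cT gT Tq eps_gt0 eps0 q1 qu.
pose z t i := Num.floor (t / eps i).
have zt t : (z t i)%:~R * eps i @[i --> F] --> t.
  apply/cvgrPdist_le => d d0.
  have H : \forall i \near F, eps i <= d by apply: cvgr_le eps0 _ d0.
  apply: filterS H => i; apply: le_trans.
  have /andP[z1 z2] := floor_itv (t / eps i).
  rewrite -/(z t i) in z1 z2.
  rewrite ler_pdivlMr // in z1; rewrite ltr_pdivrMr // intrD mulr1z mulrDl mul1r in z2.
  by rewrite ger0_norm ?subr_ge0 // lerBlDl; apply: ltW.
have ex_g t : exists k, T k /\ zexpg (q i) (z t i) @[i --> F] --> k.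
  move: cT; rewrite compact_ultra => /(_ _ (ultra_fmap (fun i => zexpg (q i) (z t i)) FF)).
  case; first by apply: nearW => i; exact: subgroup_zexpg.
  by move=> k [Tk Hk]; exists k.
have [g Hg] := choice ex_g.
have gD s t : g (s + t) = (g s * g t)%g.
  have [_ Hst] := Hg (s + t); have [_ Hs] := Hg s; have [_ Ht] := Hg t.
  have ex_b i : exists b : bool, z (s + t) i = z s i + z t i + b%:Z.
    have [b Hb] := floorD_nat (s / eps i) (t / eps i).
    by exists b; rewrite -Hb /z mulrDl.
  have [b Hb] := choice ex_b.
  have qb : (if b i then q i else 1%g) @[i --> F] --> (1%g : K).
    move=> A A1; have H : \forall i \near F, A (q i) by exact: q1 _ A1.
    apply: filterS H => i Ai /=; case: (b i) => //; exact: nbhs_singleton.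
  have H := cvg_mulg (cvg_mulg Hs Ht) qb.
  apply: (cvg_unique (lie_hausdorff (s := K)) Hst).
  rewrite mulg1 in H; apply: cvg_trans; last exact: H.
  apply: near_eq_cvg; apply: nearW => i /=.
  by rewrite Hb !zexpgD; case: (b i).
have g0 : g 0 = 1%g.
  by apply: (@mulgI _ (g 0)); rewrite -gD addr0 mulg1.
have [C [t0 [C0 t00 Hnear]]] := limit_near hc hK hss FF eps_gt0 q1 qu.
have [D D0 Hest] := limit_est hc hK FF eps_gt0 q1 qu.
have {}Hnear t : `|t| <= t0 -> chart_dom c (g t) /\ `|coord c (g t) - e| <= C * `|t|.
  by apply: Hnear => //; exact: (Hg t).2.
have {}Hest t : `|AdM (g t) - 1%:M - t *: adM u| <= D * t ^+ 2.
  by apply: Hest; [exact: zt|exact: (Hg t).2].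
have near_t d : 0 < d -> \forall t \near (0 : R), `|t| <= d.
  move=> d0; apply/nbhs_normP; exists d => // t /=.
  by rewrite sub0r normrN; exact: ltW.
have coord_g : coord c (g t) @[t --> (0 : R)] --> e.
  apply/cvgrPdist_le => d d0.
  have d1 : 0 < d / C by rewrite divr_gt0.
  apply: filterS2 (near_t _ t00) (near_t _ d1) => t t1 t2.
  rewrite distrC; apply: le_trans (Hnear _ t1).2 _.
  by rewrite mulrC -ler_pdivlMr.
have cg : g t @[t --> (0 : R)] --> (1%g : K).
  have H : param c (coord c (g t)) @[t --> (0 : R)] --> (1%g : K).
    by apply: (cvg_comp _ _ coord_g); exact: param_cvg1.
  apply: cvg_trans; last exact: H.
  apply: near_eq_cvg; apply: filterS (near_t _ t00) => t t1.
  by rewrite coordK //; exact: (Hnear _ t1).1.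
exists g; split; [exact: one_param_of_local|by move=> t; exact: (Hg t).1|].
apply/is_derive_cvg; rewrite g0.
have [a a0 Ha] := adM_lower hc hss.
apply/cvgrPdist_le => d d0.
(* [d1] and [d2] are chosen so that the chart error [d1 * |y|] and the quadratic error [D * t ^+ 2]
   each cost at most half of [a * d * |t|]. *)
pose d1 := a * d / (2 * (C + 1)).
have d10 : 0 < d1 by rewrite divr_gt0 ?mulr_gt0 // ltr_wpDl // ltW.
pose d2 := a * d / (2 * (D + 1)).
have d20 : 0 < d2 by rewrite divr_gt0 ?mulr_gt0 // ltr_wpDl.
have Hd1 : \forall t \near (0 : R), `|AdM (param c (coord c (g t))) - 1%:M - adM (coord c (g t) - e)|
   <= d1 * `|coord c (g t) - e| by exact: coord_g _ (AdM_near hc d10).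
rewrite near_withinE; apply: filterS3 (near_t _ t00) (near_t _ d20) Hd1 => t t1 t2 H1 tn0.
have [dg Hc] := Hnear _ t1; rewrite coordK // in H1.
set y := coord c (g t) - e in Hc H1 *.
have lad := adM_linear hc.
have adZ := GRing.scalable_linear lad.
have adB := GRing.zmod_morphism_linear lad.
have tgt0 : 0 < `|t| by rewrite normr_gt0.
have E : u - t^-1 *: y = - (t^-1 *: (y - t *: u)).
  by rewrite [in RHS]scalerBr scalerA mulVf // scale1r opprB.
rewrite E normrN normrZ normfV ler_pdivrMl //.
rewrite -(ler_pM2l a0); apply: le_trans (Ha _) _.
have -> : adM (y - t *: u) = (AdM (g t) - 1%:M - t *: adM u) - (AdM (g t) - 1%:M - adM y).
  by rewrite adB adZ opprB [RHS]addrC addrA subrK.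
apply: le_trans (ler_normB _ _) _.
apply: le_trans (lerD (Hest t) H1) _.
have b1 : D * t ^+ 2 <= a * d * `|t| / 2.
  have Dd : (D + 1) * d2 = a * d / 2.
    by rewrite /d2; field; rewrite gt_eqF // ltr_wpDl.
  have -> : a * d * `|t| / 2 = (D + 1) * d2 * `|t| by rewrite Dd; ring.
  rewrite -(ger0_norm (sqr_ge0 t)) normrX expr2 mulrA ler_wpM2r //.
  by apply: ler_pM => //; rewrite lerDl.
have b2 : d1 * `|y| <= a * d * `|t| / 2.
  have Cd : (C + 1) * d1 = a * d / 2.
    by rewrite /d1; field; rewrite gt_eqF // ltr_wpDl // ltW.
  have -> : a * d * `|t| / 2 = d1 * ((C + 1) * `|t|) by rewrite mulrA [d1 * _]mulrC Cd; ring.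
  rewrite ler_wpM2l ?(ltW d10) //; apply: le_trans Hc _.
  by rewrite ler_wpM2r // lerDl.
by apply: le_trans (lerD b1 b2) _; rewrite -splitr mulrA mulrAC.
Qed.
End OneParameterExistence.

Lemma cst_of_quot0 (R : realType) m n (f : R -> 'M[R]_(m, n)) :
  (forall t, s^-1 *: (f (t + s) - f t) @[s --> (0 : R)^'] --> (0 : 'M[R]_(m, n))) ->
  forall t, f t = f 0.
Proof.
move=> Hf t; apply/matrixP => i j.
apply: (@is_derive_0_is_cst R (fun t => f t i j)) => {t} t.
have H : s^-1 *: (f (t + s) i j - f t i j) @[s --> (0 : R)^'] --> (0 : R).
  move/cvg_mxP/(_ i j) : (Hf t); rewrite mxE; apply: cvg_trans.
  by apply: near_eq_cvg; apply: nearW => s; rewrite !mxE.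
have E : (fun h => h^-1 *: (((fun t => f t i j) \o shift t) (h *: (1 : R)) - f t i j)) =
    (fun s => s^-1 *: (f (t + s) i j - f t i j)).
  by apply/funext => s; have sE : s *: (1 : R) = s := mulr1 s; rewrite /= sE [s + t]addrC.
by split; rewrite /derivable /derive E; [exact: cvgP H|exact: cvg_lim H].
Qed.

(** * Uniqueness, commutation and existence of one-parameter subgroups *)

Section OneParameterTheory.
Context (R : realType) (n : nat) (K : lieGroupType R n) (c : chart R n K).
Hypotheses (hc : chart_at_1 c) (hK : compact [set: K]) (hss : semisimple c).

Notation e := (coord c 1%g).
Notation AdM := (AdM c).
Notation adM := (adM c).

Lemma one_param1 (g : R -> K) : one_param_subgroup g -> g 0 = 1%g.
Proof.
by move=> [_ gD]; apply: (@mulgI _ (g 0)); rewrite -gD addr0 mulg1.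
Qed.

Lemma one_paramN (g : R -> K) t : one_param_subgroup g -> g (- t) = (g t)^-1%g.
Proof.
by move=> gP; apply: (@mulgI _ (g t)); rewrite -gP.2 subrr (one_param1 gP) mulgV.
Qed.

Lemma one_paramX (g : R -> K) t m : one_param_subgroup g -> g (t *+ m) = (g t ^+ m)%g.
Proof.
move=> gP; elim: m => [|m IH]; first by rewrite mulr0n expg0 (one_param1 gP).
by rewrite mulrS gP.2 IH expgS.
Qed.

Section Velocity.
Variables (g : R -> K) (v : 'rV[R]_n).
Hypotheses (gP : one_param_subgroup g) (gv : is_derive (0 : R) (1 : R) (fun t => coord c (g t)) v).

Lemma one_param_cvg1 : g t @[t --> (0 : R)^'] --> (1%g : K).
Proof. by rewrite -(one_param1 gP); apply: cvg_within_filter; exact: gP.1. Qed.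

Lemma one_param_quot : t^-1 *: (coord c (g t) - e) @[t --> (0 : R)^'] --> v.
Proof. by move/is_derive_cvg: gv; rewrite (one_param1 gP). Qed.

Lemma one_param_AdM : t^-1 *: (AdM (g t) - 1%:M) @[t --> (0 : R)^'] --> adM v.
Proof. exact: cvg_AdM_quot one_param_cvg1 one_param_quot. Qed.

Lemma one_param_Ad w : t^-1 *: (Ad c (g t) w - w) @[t --> (0 : R)^'] --> bracket c v w.
Proof.
have H : w *m (t^-1 *: (AdM (g t) - 1%:M)) @[t --> (0 : R)^'] --> w *m adM v.
  by apply: cvg_mulmx; [exact: cvg_cst|exact: one_param_AdM].
rewrite (muladM hc) in H; apply: cvg_trans; last exact: H.
apply: near_eq_cvg; apply: nearW => t /=.
by rewrite -scalemxAr mulmxBr mulmx1 (mulAdM hc).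
Qed.

Lemma Ad_commuting k : (forall t, (k * g t)%g = (g t * k)%g) -> Ad c k v = v.
Proof.
move=> kg; have [_ H] := cvg_conj_quot hc k one_param_cvg1 one_param_quot.
apply: (cvg_unique (@norm_hausdorff _ _) H).
apply: cvg_trans; last exact: one_param_quot.
by apply: near_eq_cvg; apply: nearW => t /=; rewrite kg mulgK.
Qed.

Lemma bracket0_of_Ad_fix w : (forall t, Ad c (g t) w = w) -> bracket c v w = 0.
Proof.
move=> gw; apply: (cvg_unique (@norm_hausdorff _ _) (@one_param_Ad w)).
apply: cvg_near_cst; apply: nearW => t; by rewrite gw subrr scaler0.
Qed.

(** The difference quotient at time [t] is the one at time 0 moved by [AdM (g t)], so its limit
    vanishes at every time. *)
Lemma Ad_fix_of_bracket0 w : bracket c v w = 0 -> forall t, Ad c (g t) w = w.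
Proof.
move=> vw0 t; rewrite -[RHS](Ad_1 hc) -(one_param1 gP).
apply: (cst_of_quot0 (f := fun t => Ad c (g t) w)) => {}t.
have H : (s^-1 *: (Ad c (g s) w - w)) *m AdM (g t) @[s --> (0 : R)^'] --> 0 *m AdM (g t).
  by apply: cvg_mulmx; [rewrite -vw0; exact: one_param_Ad|exact: cvg_cst].
rewrite mul0mx in H; apply: cvg_trans; last exact: H.
apply: near_eq_cvg; apply: nearW => s /=.
by rewrite -scalemxAl mulmxBl !(mulAdM hc) -(Ad_mul hc) -gP.2.
Qed.
End Velocity.

Lemma AdM_kernel_near1 : \forall k \near (1%g : K), AdM k = 1%:M -> k = 1%g.
Proof.
have [a a0 Ha] := AdM_lower hc hss.
have cc : coord c k @[k --> (1%g : K)] --> e by exact: (coord_cvg1 hc).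
have H : \forall k \near (1%g : K), a * `|coord c k - e| <= `|AdM (param c (coord c k)) - 1%:M|.
  exact: cc _ Ha.
apply: filterS2 (chart_dom_near hc.2) H => k dk; rewrite coordK // => H Ak.
have /eqP : `|coord c k - e| = 0.
  apply/eqP; rewrite eq_le normr_ge0 andbT -(ler_pM2l a0) mulr0.
  by apply: le_trans H _; rewrite Ak subrr normr0.
rewrite normr_eq0 subr_eq0 => /eqP ke.
by rewrite -(coordK dk) ke (param_coord1 hc).
Qed.

(** The product [h t] of [g1 t] and [g2 (- t)] has constant image under [Ad]. Near 1 only the
    identity acts trivially, so [g1] and [g2] agree for small times, and then everywhere by taking
    powers. *)
Lemma one_param_unique (g1 g2 : R -> K) v :
  one_param_subgroup g1 -> is_derive (0 : R) (1 : R) (fun t => coord c (g1 t)) v ->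
  one_param_subgroup g2 -> is_derive (0 : R) (1 : R) (fun t => coord c (g2 t)) v ->
  forall t, g1 t = g2 t.
Proof.
move=> g1P g1v g2P g2v.
pose h t := (g1 t * g2 (- t))%g.
have Ah t : AdM (h t) = 1%:M.
  rewrite -(AdM1 hc) -(mulg1 1%g) -{1}(one_param1 g1P) -(one_param1 g2P) -{2}oppr0.
  apply: (cst_of_quot0 (f := fun t => AdM (h t))) => {}t.
  have H : AdM (g2 (- t)) *m (AdM (g2 s)^-1%g *m (s^-1 *: (AdM (g1 s) - 1%:M) -
      s^-1 *: (AdM (g2 s) - 1%:M))) *m AdM (g1 t) @[s --> (0 : R)^'] -->
      AdM (g2 (- t)) *m (1%:M *m (adM v - adM v)) *m AdM (g1 t).
    apply: cvg_mulmx; last exact: cvg_cst.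
    apply: cvg_mulmx; first exact: cvg_cst.
    apply: cvg_mulmx; last by apply: cvgB; exact: one_param_AdM.
    by apply: AdM_cvg1 => //; rewrite -invg1; apply: cvg_invg; exact: one_param_cvg1.
  rewrite subrr !mulmx0 mul0mx in H; apply: cvg_trans; last exact: H.
  apply: near_eq_cvg; apply: nearW => s /=.
  rewrite -scalerBr -!scalemxAr -scalemxAl; congr (_ *: _).
  rewrite opprB addrA subrK mulmxBr (AdVM hc) mulmxBr mulmxBl mulmx1.
  rewrite -!(AdM_mul hc); congr (AdM _ - AdM _).
  rewrite /h g1P.2 opprD [- t + - s]addrC g2P.2 -(one_paramN s g2P).
  by rewrite !mulgA.
have hc1 : h t @[t --> (0 : R)] --> (1%g : K).
  have H2 : (g2 t)^-1%g @[t --> (0 : R)] --> (g2 0)^-1%g.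
    by apply: cvg_invg; exact: g2P.1.
  have H : (g1 t * (g2 t)^-1)%g @[t --> (0 : R)] --> (g1 0 * (g2 0)^-1)%g.
    by apply: cvg_mulg => //; exact: g1P.1.
  rewrite (one_param1 g1P) (one_param1 g2P) invg1 mulg1 in H.
  apply: cvg_trans; last exact: H.
  by apply: near_eq_cvg; apply: nearW => t /=; rewrite /h (one_paramN _ g2P).
have near_eq : \forall t \near (0 : R), g1 t = g2 t.
  have H : \forall t \near (0 : R), AdM (h t) = 1%:M -> h t = 1%g by exact: hc1 _ AdM_kernel_near1.
  apply: filterS H => t /(_ (Ah t)).
  by rewrite /h (one_paramN _ g2P); exact: divg1_eq.
have [r r0 Hr] := near_norm_le near_eq.
move=> t; pose m := (Num.bound (`|t| / r)).+1.
have -> : t = (t / m%:R) *+ m by rewrite -mulr_natr divfK // pnatr_eq0.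
rewrite (one_paramX _ _ g1P) (one_paramX _ _ g2P); congr (_ ^+ _)%g; apply: Hr.
rewrite subr0 normrM normfV (ger0_norm (ler0n _ m)) ler_pdivrMr ?ltr0n //.
rewrite mulrC -ler_pdivrMr //.
have /archi_boundP/ltW bt : 0 <= `|t| / r by rewrite divr_ge0 // ltW.
by apply: le_trans bt _; rewrite ler_nat.
Qed.

(** The conjugate of [g] by [k] is a one-parameter subgroup with the same velocity, hence equals
    [g]. *)
Lemma one_param_commute (g : R -> K) v k :
  one_param_subgroup g -> is_derive (0 : R) (1 : R) (fun t => coord c (g t)) v ->
  Ad c k v = v -> forall t, (k * g t)%g = (g t * k)%g.
Proof.
move=> gP gv kv t.
have gP' : one_param_subgroup (fun t => k * g t * k^-1)%g.
  split=> [s|s u]; last by rewrite gP.2 !mulgA mulgVK.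
  apply: cvg_mulg; last exact: cvg_cst.
  by apply: cvg_mulg; [exact: cvg_cst|exact: gP.1].
have gv' : is_derive (0 : R) (1 : R) (fun t => coord c (k * g t * k^-1)%g) v.
  have [_ H] := cvg_conj_quot hc k (one_param_cvg1 gP) (one_param_quot gP gv).
  by apply/is_derive_cvg; rewrite (one_param1 gP) mulg1 mulgV; rewrite kv in H.
by rewrite [in RHS](one_param_unique gP gv gP' gv') mulgVK.
Qed.

Lemma one_param_exists v : exists g : R -> K, one_param_subgroup g /\
  is_derive (0 : R) (1 : R) (fun t => coord c (g t)) v.
Proof.
have [F [FU sF]] := @ultraFilterLemma nat (\oo) _.
have eps0 : (@harmonic R) @ F --> (0 : R) by apply: cvg_trans (@cvg_harmonic R); exact: cvg_app.
have epsn0 i : (@harmonic R) i != 0 by rewrite invr_neq0 // pnatr_eq0.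
have [q1 qv] := param_line hc v eps0 (nearW _ epsn0).
have [] := @lie_subalgebra_limit R n K c hc hK hss setT nat F FU _ _ v _ _ _ _ eps0 q1 qv => //.
  by move=> i; rewrite invr_gt0 ltr0n.
by move=> g [gP _ gv]; exists g.
Qed.

(** Antisymmetry is not visible in the definition of the bracket; it comes from the commutativity of
    the one-parameter subgroup with velocity [v]. *)
Lemma bracketvv v : bracket c v v = 0.
Proof.
have [g [gP gv]] := one_param_exists v.
apply: (bracket0_of_Ad_fix gP gv) => t.
by apply: (Ad_commuting gP gv) => s; rewrite -!gP.2 addrC.
Qed.

Lemma bracketC u v : bracket c u v = - bracket c v u.
Proof.
have := bracketvv (u + v).
have addl x y w : bracket c (x + y) w = bracket c x w + bracket c y w.
  by have := bracket_linearl hc w 1 x y; rewrite !scale1r.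
have addr' x y w : bracket c w (x + y) = bracket c w x + bracket c w y.
  by have := bracket_linear hc w 1 x y; rewrite !scale1r.
rewrite (addl u v (u + v)) (addr' u v u) (addr' u v v).
move: (bracketvv u) (bracketvv v).
move: (bracket c u u) (bracket c u v) (bracket c v u) (bracket c v v) => w1 w2 w3 w4 -> ->.
rewrite add0r addr0 => /eqP.
by rewrite addr_eq0 => /eqP.
Qed.

End OneParameterTheory.

(** * The inner product *)

Lemma norm_sq_le (R : realType) n (y : 'rV[R]_n) : `|y| ^+ 2 <= (y *m y^T) 0 0.
Proof.
have E : (y *m y^T) 0 0 = \sum_j y 0 j ^+ 2.
  by rewrite mxE; apply: eq_bigr => j _; rewrite mxE expr2.
have [->|y0] := eqVneq `|y| 0.
  by rewrite expr0n E sumr_ge0 // => j _; exact: sqr_ge0.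
have [[i k] /= yk] := mx_norm_neq0 y0.
rewrite [`|y|]yk ord1 -normrX ger0_norm ?sqr_ge0 // E (bigD1 k) //= lerDl.
by apply: sumr_ge0 => j _; exact: sqr_ge0.
Qed.

Lemma perturb_congr (R : comNzRingType) n (a : R) (X S : 'M[R]_n) :
  (1%:M + a *: X) *m S *m (1%:M + a *: X)^T - S =
  a *: (X *m S + S *m X^T + a *: (X *m S *m X^T)).
Proof.
have -> : (1%:M + a *: X)^T = 1%:M + a *: X^T by apply/matrixP => i j; rewrite !mxE eq_sym.
rewrite mulmxDl mul1mx mulmxDr mulmx1 mulmxDl -!scalemxAl -!scalemxAr.
by rewrite [LHS]addrC -!addrA addKr !scalerDr.
Qed.

Section SkewTrace.
Context (R : realType) (n : nat).
Implicit Types (S M : 'M[R]_n).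

Definition posdef S := S^T = S /\ forall x : 'rV[R]_n, x != 0 -> 0 < (x *m S *m x^T) 0 0.

(** Gram-Schmidt, one row at a time: fewer than [n] rows leave a nonzero orthogonal vector. *)
Lemma orthonormal_basis S : posdef S -> exists P : 'M[R]_n, P *m S *m P^T = 1%:M.
Proof.
move=> [Ssym Spos].
suff H r : (r <= n)%N -> exists P : 'M[R]_(r, n), P *m S *m P^T = 1%:M by exact: H.
elim: r => [_|r IH rn].
  by exists 0; apply/matrixP => -[].
have [P HP] := IH (ltnW rn).
have [x x0 xP] : exists2 x : 'rV[R]_n, x != 0 & x *m (S *m P^T) = 0.
  have : kermx (S *m P^T) != 0.
    by rewrite kermx_eq0 /row_free neq_ltn (leq_ltn_trans (rank_leq_col _) rn).
  case/rowV0Pn => x xk x0; exists x => //; exact/sub_kermxP.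
pose a := Num.sqrt ((x *m S *m x^T) 0 0).
have a0 : 0 < a by rewrite sqrtr_gt0 Spos.
pose y := a^-1 *: x.
have yP : y *m S *m P^T = 0 by rewrite -mulmxA -scalemxAl xP scaler0.
have Py : P *m S *m y^T = 0.
  by apply: trmx_inj; rewrite trmx0 -yP !trmx_mul trmxK Ssym mulmxA.
have yy : y *m S *m y^T = 1%:M.
  have -> : y *m S *m y^T = (a^-1 * a^-1) *: (x *m S *m x^T).
    by rewrite /y linearZ /= -scalemxAr -!scalemxAl scalerA.
  rewrite [x *m S *m x^T]mx11_scalar -(sqr_sqrtr (ltW (Spos x x0))) -/a.
  by rewrite scale_scalar_mx expr2 mulrACA !mulVf ?gt_eqF // mulr1.
rewrite -[r.+1]addn1; exists (col_mx P y).
by rewrite mul_col_mx tr_col_mx mul_col_row HP yP Py yy -scalar_mx_block.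
Qed.

(** In an orthonormal basis [M] becomes an antisymmetric [A], and the trace of its square is minus
    the sum of the squared entries. *)
Lemma skew_trace S M : posdef S -> M *m S + S *m M^T = 0 -> M != 0 -> \tr (M *m M) < 0.
Proof.
move=> Sp MS M0; have [P HP] := orthonormal_basis Sp.
have [Q QE] : exists Q, Q = S *m P^T by exists (S *m P^T).
have PQ : P *m Q = 1%:M by rewrite QE mulmxA.
have QP : Q *m P = 1%:M by exact: mulmx1C.
have [A AE] : exists A, A = P *m M *m Q by exists (P *m M *m Q).
have AT : A^T = - A.
  rewrite AE QE !trmx_mul trmxK Sp.1 !mulmxA -(mulmxA P S).
  have -> : S *m M^T = - (M *m S) by apply/eqP; rewrite -addr_eq0 addrC MS.
  by rewrite mulmxN mulNmx !mulmxA.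
have ME : M = Q *m A *m P by rewrite AE !mulmxA QP mul1mx -mulmxA QP mulmx1.
have A0 : A != 0 by apply: contra_neq M0 => A0; rewrite ME A0 mulmx0 mul0mx.
have -> : \tr (M *m M) = - \tr (A *m A^T).
  rewrite AT mulmxN linearN opprK.
  have -> : A *m A = P *m (M *m M *m Q).
    by rewrite AE !mulmxA -(mulmxA (P *m M) Q P) QP mulmx1.
  by rewrite [RHS]mxtrace_mulC -(mulmxA (M *m M) Q P) QP mulmx1.
rewrite oppr_lt0 /mxtrace.
have E i : (A *m A^T) i i = \sum_j A i j ^+ 2.
  by rewrite mxE; apply: eq_bigr => j _; rewrite mxE expr2.
rewrite lt_neqAle; apply/andP; split; last first.
  by apply: sumr_ge0 => i _; rewrite E; apply: sumr_ge0 => j _; exact: sqr_ge0.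
apply: contra A0; rewrite eq_sym psumr_eq0 => [/allP /= H|i _]; last first.
  by rewrite E; apply: sumr_ge0 => j _; exact: sqr_ge0.
apply/eqP/matrixP => i j; rewrite mxE.
have := H i (mem_index_enum i); rewrite E psumr_eq0 => [/allP /= Hi|k _]; last exact: sqr_ge0.
by have := Hi j (mem_index_enum j); rewrite sqrf_eq0 => /eqP.
Qed.
End SkewTrace.

Section InnerProduct.
Context (R : realType) (n : nat) (K : lieGroupType R n) (c : chart R n K).
Hypotheses (hc : chart_at_1 c) (hK : compact [set: K]) (hss : semisimple c).

Notation e := (coord c 1%g).
Notation AdM := (AdM c).
Notation adM := (adM c).

(* Averaging over powers of [Ad_q] for [q] closer and closer to 1 in the
   direction [v] yields, in the limit, an inner product for which [ad_v] is
   skew; no Haar measure is needed. *)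
Lemma adM_skew v : exists S, posdef S /\ adM v *m S + S *m (adM v)^T = 0.
Proof.
have [F [FU sF]] := @ultraFilterLemma nat (\oo) _.
have eps0 : (@harmonic R) @ F --> (0 : R) by apply: cvg_trans (@cvg_harmonic R); exact: cvg_app.
have epsn0 i : (@harmonic R) i != 0 by rewrite invr_neq0 // pnatr_eq0.
pose q i := param c (e + (@harmonic R) i *: v).
have [q1 qv] := param_line hc v eps0 (nearW _ epsn0).
pose E i := (@harmonic R i)^-1 *: (AdM (q i) - 1%:M).
have EM : E @ F --> adM v by exact: cvg_AdM_quot.
have [C C0 HC] := AdM_bounded hc hK.
pose B i m := AdM (q i ^+ m)%g.
(* Moving the average by [q i] telescopes to an error of order [1 / N i], which is then divided by
   [h i = 1 / (i + 1)]. The square makes the quotient tend to 0. *)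
pose N i := (i.+1 ^ 2)%N.
have N0 i : 0 < (N i)%:R :> R by rewrite ltr0n expn_gt0.
pose S i : 'M[R]_n := (N i)%:R^-1 *: \sum_(m < N i) B i m *m (B i m)^T.
have BT i m : `|B i m *m (B i m)^T| <= n%:R * C * C.
  apply: le_trans (mx_normM _ _) _.
  have BC : `|(B i m)^T| <= C.
    apply: mx_norm_leP => [|k l]; first exact: ltW.
    by rewrite mxE; apply: le_trans (mx_norm_entry _ _ _) (HC _).
  by apply: ler_pM => //; rewrite ?mulr_ge0 // ler_wpM2l //; exact: HC.
have Sb i : `|S i| <= n%:R * C * C.
  rewrite normrZ normfV ger0_norm // ler_pdivrMl //.
  apply: le_trans (ler_norm_sum _ _ _) _.
  have -> : (N i)%:R * (n%:R * C * C) = \sum_(m < N i) n%:R * C * C.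
    by rewrite sumr_const card_ord mulr_natl.
  exact: ler_sum.
have [S0 HS0] : exists S0 : 'M[R]_n, S @ F --> S0.
  exact: (ultra_bounded_cvg (nearW _ Sb)).
have trcvg (m1 m2 : nat) (f : nat -> 'M[R]_(m1, m2)) (A : 'M[R]_(m1, m2)) :
    f @ F --> A -> (f i)^T @[i --> F] --> A^T.
  move=> /cvg_mxP fA; apply/cvg_mxP => i j; rewrite mxE.
  apply: cvg_trans; last exact: (fA j i).
  by apply: near_eq_cvg; apply: nearW => k; rewrite mxE.
exists S0; split; first split.
- apply: (cvg_unique (@norm_hausdorff _ _) (trcvg _ _ _ _ HS0)).
  apply: cvg_trans; last exact: HS0.
  apply: near_eq_cvg; apply: nearW => i; apply/esym.
  rewrite [LHS]linearZ /=; congr (_ *: _).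
  by rewrite linear_sum; apply: eq_bigr => m _; rewrite /= trmx_mul trmxK.
- move=> x x0.
  (* The inverses of the powers are bounded as well, so no term of the average falls below [a ^+ 2],
     and the limit remains positive definite. *)
  pose a := (n%:R * C + 1)^-1 * `|x|.
  have nC : 0 < n%:R * C + 1 by rewrite ltr_wpDl // mulr_ge0 // ltW.
  have a0 : 0 < a by rewrite mulr_gt0 ?invr_gt0 ?normr_gt0.
  apply: (@lt_le_trans _ _ (a ^+ 2)); first by rewrite exprn_gt0.
  have H : (x *m S i *m x^T) 0 0 @[i --> F] --> (x *m S0 *m x^T) 0 0.
    have : x *m S i *m x^T @[i --> F] --> x *m S0 *m x^T.
      by apply: cvg_mulmx; [apply: cvg_mulmx => //; exact: cvg_cst|exact: cvg_cst].
    by move/cvg_mxP; exact.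
  apply: cvgr_to_ge H _; apply: nearW => i.
  have term m : a ^+ 2 <= (x *m (B i m *m (B i m)^T) *m x^T) 0 0.
    set y := x *m B i m.
    have -> : x *m (B i m *m (B i m)^T) *m x^T = y *m y^T by rewrite /y trmx_mul !mulmxA.
    have ay : a <= `|y|.
      rewrite /a ler_pdivrMl //.
      have -> : x = y *m AdM ((q i ^+ m)^-1)%g by rewrite /y -mulmxA (AdMV hc) mulmx1.
      apply: le_trans (mx_normM _ _) _; rewrite mulrAC ler_wpM2r //.
      by apply: ler_wpDr => //; rewrite ler_wpM2l.
    by apply: le_trans (norm_sq_le y); rewrite lerXn2r ?nnegrE // ltW.
  have -> : (x *m S i *m x^T) 0 0 = (N i)%:R^-1 * \sum_(m < N i) (x *m (B i m *m (B i m)^T) *m x^T) 0 0.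
    rewrite /S -scalemxAr -scalemxAl mxE mulmx_sumr mulmx_suml summxE //.
  rewrite ler_pdivlMl //.
  have -> : (N i)%:R * a ^+ 2 = \sum_(m < N i) a ^+ 2.
    by rewrite sumr_const card_ord mulr_natl.
  by apply: ler_sum => m _; exact: term.
pose h := @harmonic R.
have HL : E i *m S i + S i *m (E i)^T + h i *: (E i *m S i *m (E i)^T) @[i --> F] -->
    adM v *m S0 + S0 *m (adM v)^T + 0 *: (adM v *m S0 *m (adM v)^T).
  have HT := trcvg _ _ _ _ EM.
  apply: cvgD; first apply: cvgD.
  - exact: cvg_mulmx.
  - exact: cvg_mulmx.
  - by apply: cvgZ => //; apply: cvg_mulmx => //; exact: cvg_mulmx.
rewrite scale0r addr0 in HL.
apply: (cvg_unique (@norm_hausdorff _ _) HL).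
apply: norm_cvg0.
have HR : h i * (n%:R * C * C + `|1%:M : 'M[R]_n|) @[i --> F] -->
    (0 * (n%:R * C * C + `|1%:M : 'M[R]_n|) : R).
  by apply: cvgM => //; exact: cvg_cst.
rewrite mul0r in HR.
apply: squeeze_cvgr (cvg_cst 0) HR; apply: nearW => i.
rewrite normr_ge0 /=.
have h0 : 0 < h i by exact: harmonic_gt0.
have AE : AdM (q i) = 1%:M + h i *: E i by rewrite /E scalerA divff ?gt_eqF // scale1r addrC subrK.
have E1 : AdM (q i) *m S i *m (AdM (q i))^T - S i =
   (N i)%:R^-1 *: (B i (N i) *m (B i (N i))^T - 1%:M).
  rewrite /S -scalemxAr -scalemxAl -scalerBr; congr (_ *: _).
  rewrite mulmx_sumr mulmx_suml.
  have -> : \sum_(m < N i) AdM (q i) *m (B i m *m (B i m)^T) *m (AdM (q i))^T =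
      \sum_(m < N i) B i m.+1 *m (B i m.+1)^T.
    by apply: eq_bigr => m _; rewrite /B expgSr (AdM_mul hc) trmx_mul !mulmxA.
  rewrite -sumrB -(big_mkord xpredT (fun m => B i m.+1 *m (B i m.+1)^T - B i m *m (B i m)^T)).
  rewrite telescope_sumr //.
  by rewrite {3 4}/B expg0 (AdM1 hc) trmx1 mulmx1.
have -> : E i *m S i + S i *m (E i)^T + h i *: (E i *m S i *m (E i)^T) =
    h i *: (B i (N i) *m (B i (N i))^T - 1%:M).
  have -> : E i *m S i + S i *m (E i)^T + h i *: (E i *m S i *m (E i)^T) =
      (h i)^-1 *: (AdM (q i) *m S i *m (AdM (q i))^T - S i).
    by rewrite AE perturb_congr scalerA mulVf ?gt_eqF // scale1r.
  rewrite E1 scalerA; congr (_ *: _).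
  have -> : (N i)%:R = (h i)^-1 ^+ 2 by rewrite /N natrX /h /= invrK.
  by rewrite exprVn (invrK (h i ^+ 2)) expr2 mulrA mulVf ?gt_eqF // mul1r.
rewrite normrZ (ger0_norm (ltW h0)) (ler_wpM2l (ltW h0)) //.
by apply: le_trans (ler_normB _ _) _; rewrite lerD2r.
Qed.

Lemma innerE v w : inner c v w = - \tr (adM w *m adM v).
Proof.
congr (- \tr _); apply: mx_ext => u.
rewrite mulmxA !(muladM hc); apply: mul_rV_linear => a x y /=.
by rewrite (bracket_linear hc w a x y) (bracket_linear hc v a).
Qed.

Lemma inner_gt0 v : v != 0 -> 0 < inner c v v.
Proof.
move=> v0; rewrite innerE oppr_gt0.
have [S [Sp MS]] := adM_skew v.
apply: (skew_trace Sp MS); apply: contra_neq v0; exact: adM_inj.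
Qed.

End InnerProduct.

(** * Commuting skew operators *)

Section CommutingSkew.
Context (R : realType) (n : nat).
Variable S : 'M[R]_n.
Hypothesis Sp : posdef S.

Definition form (x y : 'rV[R]_n) : R := (x *m S *m y^T) 0 0.

Lemma form_sym x y : form x y = form y x.
Proof.
rewrite /form -[in LHS](trmxK (x *m S *m y^T)) [LHS]mxE.
by rewrite !trmx_mul trmxK Sp.1 mulmxA.
Qed.

Lemma formDl x x' y : form (x + x') y = form x y + form x' y.
Proof. by rewrite /form !mulmxDl mxE. Qed.

Lemma formZl a x y : form (a *: x) y = a * form x y.
Proof. by rewrite /form -!scalemxAl mxE. Qed.

Lemma formDr x y y' : form x (y + y') = form x y + form x y'.
Proof. by rewrite form_sym formDl !(form_sym x). Qed.

Lemma formZr a x y : form x (a *: y) = a * form x y.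
Proof. by rewrite form_sym formZl (form_sym x). Qed.

Lemma form_gt0 x : x != 0 -> 0 < form x x. Proof. exact: Sp.2. Qed.

Lemma form_eq0 x : form x x = 0 -> x = 0.
Proof. by move=> xx; apply/eqP/negPn/negP => /form_gt0; rewrite xx ltxx. Qed.

Lemma form0l x : form 0 x = 0. Proof. by rewrite /form !mul0mx mxE. Qed.

Lemma form_ge0 x : 0 <= form x x.
Proof. by have [->|/form_gt0/ltW//] := eqVneq x 0; rewrite form0l. Qed.

Lemma formNr x y : form x (- y) = - form x y.
Proof. by rewrite -scaleN1r formZr mulN1r. Qed.

Lemma formBl x y z : form (x - y) z = form x z - form y z.
Proof. by rewrite formDl -scaleN1r formZl mulN1r. Qed.

(** Meant for [x1], [y1] the images of [x], [y] under an isometry and [x2] the image of [x] under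
    its inverse: the expansion is the sum of the two gaps [<x,y> - <x1,y>] and [<x,y> - <x2,y>]. *)
Lemma form_moved_ge0 x y x1 y1 x2 :
  form x1 y1 = form x y -> form x y1 = form x2 y ->
  form x1 y <= form x y -> form x2 y <= form x y ->
  0 <= form (x1 - x) (y1 - y).
Proof.
move=> E1 E2 E3 E4; rewrite formBl !(form_sym _ (y1 - y)) !formBl.
by rewrite !(form_sym y1) !(form_sym y) E1 E2 opprB addr_ge0 // subr_ge0.
Qed.

Lemma form_lower : exists2 a : R, 0 < a & forall x, a * `|x| ^+ 2 <= form x x.
Proof.
have [P HP] := orthonormal_basis Sp.
have [Q QE] : exists Q, Q = S *m P^T by exists (S *m P^T).
have QP : Q *m P = 1%:M by apply: mulmx1C; rewrite QE mulmxA.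
pose b := n%:R * `|P| + 1.
have b0 : 0 < b by rewrite ltr_wpDl // mulr_ge0.
exists (b ^- 2); first by rewrite invr_gt0 exprn_gt0.
move=> x; pose y := x *m Q.
have -> : form x x = (y *m y^T) 0 0.
  have xE : x = y *m P by rewrite /y -mulmxA QP mulmx1.
  by rewrite /form {1 2}xE trmx_mul !mulmxA -(mulmxA y P) -(mulmxA y) HP mulmx1.
apply: le_trans (norm_sq_le y); rewrite mulrC ler_pdivrMr ?exprn_gt0 //.
rewrite -exprMn lerXn2r ?nnegrE ?mulr_ge0 // ?(ltW b0) //.
rewrite -{1}(mulmx1 x) -QP mulmxA -/y.
apply: le_trans (mx_normM _ _) _; rewrite mulrAC mulrC ler_wpM2l //.
by rewrite lerDl.
Qed.

Lemma cvg_form T (F : set_system T) {FF : Filter F} (f g : T -> 'rV[R]_n) (x y : 'rV[R]_n) :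
  f @ F --> x -> g @ F --> y -> form (f i) (g i) @[i --> F] --> form x y.
Proof.
move=> fx gy.
have gyT : (g i)^T @[i --> F] --> y^T.
  apply/cvg_mxP => i j; rewrite mxE; move/cvg_mxP/(_ j i) : gy; apply: cvg_trans.
  by apply: near_eq_cvg; apply: nearW => k; rewrite mxE.
have /cvg_mxP : f i *m S *m (g i)^T @[i --> F] --> x *m S *m y^T.
  by apply: cvg_mulmx => //; apply: cvg_mulmx => //; exact: cvg_cst.
exact.
Qed.

Lemma symmetric_eigenvector (V A : 'M[R]_n) : V != 0 -> (V *m A <= V)%MS ->
  (forall x y : 'rV[R]_n, (x <= V)%MS -> (y <= V)%MS -> form (x *m A) y = form x (y *m A)) ->
  exists (a : R) (x : 'rV[R]_n), [/\ (x <= V)%MS, x != 0 & x *m A = a *: x].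
Proof.
move=> V0 VA Asym.
pose D := [set x : 'rV[R]_n | (x <= V)%MS /\ form x x = 1].
have [v vV v0] : exists2 v : 'rV[R]_n, (v <= V)%MS & v != 0 by exact/rowV0Pn.
have normalize x : (x <= V)%MS -> x != 0 -> D ((Num.sqrt (form x x))^-1 *: x).
  move=> xV x0; split; first exact: scalemx_sub.
  rewrite formZl formZr mulrA -invfM -expr2 sqr_sqrtr ?form_ge0 // mulVf //.
  by rewrite gt_eqF // form_gt0.
have D0 : D !=set0 by exists ((Num.sqrt (form v v))^-1 *: v); exact: normalize.
have cD : compact D.
  have [b b0 Hb] := form_lower.
  have bK : b * b^-1 = 1 by rewrite divff // gt_eqF.
  apply: bounded_closed_compact.
    exists (b^-1 + 1); split; first exact: num_real.
    move=> M bM x [_ x1]; apply: le_trans (ltW bM); have := Hb x; rewrite x1 => Hx.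
    rewrite leNgt; apply/negP => xM.
    have b1 : 0 < b^-1 by rewrite invr_gt0.
    by nra.
  have -> : D = (fun x : 'rV[R]_n => x *m cokermx V) @^-1` [set 0] `&`
      (fun x => form x x) @^-1` [set 1].
    apply/seteqP; split => x [/= xV x1]; split => //; first by apply/eqP; rewrite -submxE.
    by rewrite submxE; apply/eqP.
  apply: closedI; apply: preimage_closed.
  - move=> x _; exact: (cvg_mulmx (@cvg_id _ (nbhs x)) (@cvg_cst _ (cokermx V) _ (nbhs x) _)).
  - exact/accessible_closed_set1/hausdorff_accessible/norm_hausdorff.
  - move=> x _; exact: (cvg_form (@cvg_id _ (nbhs x)) (@cvg_id _ (nbhs x))).
  - exact/accessible_closed_set1/hausdorff_accessible/norm_hausdorff.
have cf : {within D, continuous (fun x => form (x *m A) x)}.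
  apply: continuous_subspaceT => x.
  exact: (cvg_form (cvg_mulmx (@cvg_id _ (nbhs x)) (@cvg_cst _ A _ (nbhs x) _)) (@cvg_id _ (nbhs x))).
(* [x0] maximises the Rayleigh quotient of [A] on [V]. *)
have [x0 /set_mem[xV xx] xmax] := compact_EVT_max D0 cD cf.
pose a := form (x0 *m A) x0.
have x00 : x0 != 0 by apply/eqP => x0E; move: xx; rewrite x0E form0l => /esym/eqP; rewrite oner_eq0.
exists a, x0; split => //.
have Bge0 y : (y <= V)%MS -> 0 <= a * form y y - form (y *m A) y.
  move=> yV; have [->|y0] := eqVneq y 0; first by rewrite mul0mx form0l mulr0 subrr.
  have := xmax _ (mem_set (normalize _ yV y0)).
  rewrite -/a -scalemxAl formZl formZr mulrA -invfM -expr2 sqr_sqrtr ?form_ge0 //.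
  by rewrite mulrC ler_pdivrMr ?form_gt0 // subr_ge0.
have [z zE] : exists z, z = a *: x0 - x0 *m A by exists (a *: x0 - x0 *m A).
have zV : (z <= V)%MS.
  rewrite zE addmx_sub ?scalemx_sub // eqmx_opp.
  exact: submx_trans (submxMr _ xV) VA.
(* The positive semidefinite form [a <y, y> - <y A, y>] vanishes at [x0], so
   its derivative at [x0] along [z] is zero. *)
have zz : form z z = 0.
  pose p := a * form z z - form (z *m A) z.
  have E t : a * form (x0 - t *: z) (x0 - t *: z) - form ((x0 - t *: z) *m A) (x0 - t *: z) =
     t ^+ 2 * p - 2 * t * form z z.
    have -> : form z z = a * form x0 z - form (x0 *m A) z.
      by rewrite {1}zE formDl formZl -scaleN1r formZl mulN1r.
    have zx : form (z *m A) x0 = form (x0 *m A) z by rewrite Asym // form_sym.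
    rewrite -scaleNr mulmxDl -scalemxAl !(formDl, formDr, formZl, formZr) zx.
    by rewrite (form_sym z x0) xx /p -/a; ring.
  have p0 : 0 <= p by exact: Bge0.
  have z0 := form_ge0 z.
  have p1 : 0 < p + 1 by rewrite ltr_wpDl.
  (* With this [t] the inequality becomes [t^2 p - 2 t^2 (p + 1) >= 0], which forces [t = 0]; adding
     1 avoids dividing by [p = 0]. *)
  pose t := form z z / (p + 1).
  have tE : form z z = t * (p + 1) by rewrite divfK // gt_eqF.
  have : 0 <= t ^+ 2 * p - 2 * t * form z z.
    rewrite -E; apply: Bge0.
    by rewrite addmx_sub // eqmx_opp scalemx_sub.
  rewrite tE => Ht.
  have t2 : t ^+ 2 = 0 by apply/eqP; rewrite eq_le sqr_ge0 andbT; nra.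
  by move/eqP: t2; rewrite sqrf_eq0 => /eqP ->; rewrite mul0r.
by apply/eqP; rewrite -subr_eq0 -opprB -zE (form_eq0 zz) oppr0.
Qed.
Variable Ms : set 'M[R]_n.
Hypothesis skew : forall M, Ms M -> M *m S + S *m M^T = 0.
Hypothesis comm : forall M M', Ms M -> Ms M' -> M *m M' = M' *m M.

Lemma form_skew M x y : Ms M -> form (x *m M) y = - form x (y *m M).
Proof.
move=> /skew MS; have MSE : M *m S = - (S *m M^T) by apply/eqP; rewrite -addr_eq0 MS.
by rewrite /form -(mulmxA x M S) MSE mulmxN mulNmx mxE trmx_mul !mulmxA.
Qed.

Definition invariant (V : 'M[R]_n) := V != 0 /\ forall M, Ms M -> (V *m M <= V)%MS.

Lemma minimal_invariant V1 : invariant V1 -> exists V, [/\ invariant V, (V <= V1)%MS &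
  forall U, invariant U -> (U <= V)%MS -> (V <= U)%MS].
Proof.
move=> V1i.
pose Q d := `[< exists V, [/\ invariant V, (V <= V1)%MS & \rank V = d] >].
have exQ : exists d, Q d by exists (\rank V1); apply/asboolP; exists V1.
have [d /asboolP[V [Vi VV1 Vd]] dmin] := ex_minnP exQ.
exists V; split => // U Ui UV.
have dU : (d <= \rank U)%N.
  by apply: dmin; apply/asboolP; exists U; split => //; exact: submx_trans VV1.
by rewrite -(geq_leqif (mxrank_leqif_sup UV)) Vd.
Qed.

(** An eigenspace of [A] in [V] is stable under everything commuting with [A], so minimality makes
    it all of [V]. *)
Lemma invariant_scalar V A : invariant V ->
  (forall U, invariant U -> (U <= V)%MS -> (V <= U)%MS) ->
  (V *m A <= V)%MS -> (forall M, Ms M -> A *m M = M *m A) ->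
  (forall x y : 'rV[R]_n, form (x *m A) y = form x (y *m A)) ->
  exists a : R, forall x : 'rV[R]_n, (x <= V)%MS -> x *m A = a *: x.
Proof.
move=> [V0 VM] Vmin VA AM Asym.
have [a [x [xV x0 xA]]] := symmetric_eigenvector V0 VA (fun x y _ _ => Asym x y).
exists a; pose U := (V :&: kermx (A - a%:M))%MS.
have memU (y : 'rV[R]_n) : (y <= U)%MS = (y <= V)%MS && (y *m A == a *: y).
  rewrite sub_capmx; congr andb; apply/sub_kermxP/eqP; rewrite mulmxBr mul_mx_scalar => /eqP.
    by rewrite subr_eq0 => /eqP.
  by rewrite -subr_eq0 => /eqP.
have Ui : invariant U.
  split; first by apply/rowV0Pn; exists x => //; rewrite memU xV xA eqxx.
  move=> M MM; apply/rV_subP => y /submxP[z ->]; rewrite mulmxA.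
  have : (z *m U <= U)%MS by exact: submxMl.
  move: (z *m U) => {z}z.
  rewrite !memU => /andP[zV /eqP zA]; apply/andP; split.
    exact: submx_trans (submxMr _ zV) (VM _ MM).
  by rewrite -(mulmxA z) -AM // mulmxA zA scalemxAl.
have VU := Vmin _ Ui (capmxSl _ _).
by move=> y yV; have := submx_trans yV VU; rewrite memU => /andP[_ /eqP].
Qed.

(* A minimal invariant subspace [V] is a plane or a line on which, by Schur's
   lemma for symmetric operators, the square of [M0] is a negative scalar and
   every [M] is a multiple of the complex structure [J] proportional to [M0]. *)
Lemma common_rotation V1 M0 : invariant V1 -> Ms M0 ->
  (forall x : 'rV[R]_n, (x <= V1)%MS -> x *m M0 = 0 -> x = 0) ->
  exists X Y : 'rV[R]_n, [/\ X != 0, (X <= V1)%MS, (Y <= V1)%MS &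
    exists2 b : 'M[R]_n -> R, b M0 != 0 &
      forall M, Ms M -> X *m M = - b M *: Y /\ Y *m M = b M *: X].
Proof.
move=> V1i MM0 inj0.
have [V [Vi VV1 Vmin]] := minimal_invariant V1i.
have VM M : Ms M -> (V *m M <= V)%MS by exact: Vi.2.
have stM M M' : Ms M -> Ms M' -> (V *m (M *m M') <= V)%MS.
  by move=> h h'; rewrite mulmxA; apply: submx_trans (submxMr _ (VM _ h)) (VM _ h').
have [mu Hmu] : exists a : R, forall x : 'rV[R]_n, (x <= V)%MS -> x *m (M0 *m M0) = a *: x.
  apply: invariant_scalar => //; first exact: stM.
    by move=> M h; rewrite -mulmxA (comm MM0 h) !mulmxA (comm MM0 h).
  by move=> x y; rewrite !mulmxA !form_skew // opprK.
have [X XV X0] : exists2 X : 'rV[R]_n, (X <= V)%MS & X != 0 by apply/rowV0Pn; exact: Vi.1.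
have mu0 : mu < 0.
  have XM0 : X *m M0 != 0.
    by apply: contra_neq X0; apply: inj0; exact: submx_trans VV1.
  have := form_gt0 XM0; rewrite form_skew // -mulmxA Hmu // formZr oppr_gt0.
  by rewrite pmulr_llt0 // form_gt0.
pose l := Num.sqrt (- mu).
have l0 : 0 < l by rewrite sqrtr_gt0 oppr_gt0.
have l2 : l * l = - mu by rewrite -expr2 sqr_sqrtr // oppr_ge0 ltW.
(* [M0 *m M] is symmetric, as a product of commuting skew operators, so it is scalar on [V]; since
   the square of [M0] is a nonzero scalar there, this determines [M] on [V]. *)
have ex_b M : exists a : R, Ms M -> forall x : 'rV[R]_n, (x <= V)%MS -> x *m (M0 *m M) = a *: x.
  have [h|h] := pselect (Ms M); last by exists 0.
  have [a Ha] : exists a : R, forall x : 'rV[R]_n, (x <= V)%MS -> x *m (M0 *m M) = a *: x.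
    apply: invariant_scalar => //; first exact: stM.
      by move=> M' h'; rewrite -mulmxA (comm h h') !mulmxA (comm MM0 h').
    by move=> x y; rewrite !mulmxA !form_skew // opprK -!mulmxA (comm MM0 h).
  by exists a.
have [b Hb] := choice ex_b.
have YV : (l^-1 *: (X *m M0) <= V)%MS.
  by apply: scalemx_sub; apply: submx_trans (submxMr _ XV) (VM _ MM0).
exists X, (l^-1 *: (X *m M0)); split => //; try exact: submx_trans VV1.
exists (fun M => l^-1 * b M).
  have bM0 : b M0 != 0.
    apply/eqP => b0; have : mu *: X = 0 by rewrite -Hmu // Hb // b0 scale0r.
    by move/eqP; rewrite scaler_eq0 (negPf X0) orbF (lt_eqF mu0).
  by rewrite mulf_neq0 // invr_neq0 // gt_eqF.
move=> M h; split; last by rewrite -scalemxAl -mulmxA Hb // scalerA.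
have : (X *m M) *m (M0 *m M0) = mu *: (X *m M).
  by apply: Hmu; apply: submx_trans (submxMr _ XV) (VM _ h).
have -> : (X *m M) *m (M0 *m M0) = b M *: (X *m M0).
  by rewrite !mulmxA -(mulmxA X M M0) -(comm MM0 h) Hb // -scalemxAl.
move=> H; have -> : X *m M = mu^-1 *: (b M *: (X *m M0)) by rewrite H scalerA mulVf ?scale1r ?lt_eqF.
rewrite !scalerA; congr (_ *: _).
rewrite mulNr mulrAC -invfM l2 invrN mulNr opprK //.
Qed.
End CommutingSkew.

(** * Maximal tori *)

Section MaximalTorus.
Context (R : realType) (n : nat) (K : lieGroupType R n) (c : chart R n K).
Hypotheses (hc : chart_at_1 c) (hK : compact [set: K]) (hss : semisimple c).

Notation e := (coord c 1%g).
Notation AdM := (AdM c).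
Notation adM := (adM c).

Variable T : set K.
Hypothesis tT : torus T.

Let gT : subgroup T. Proof. by case: tT. Qed.
Let T1 : T 1%g. Proof. by case: gT. Qed.
Let TM p q : T p -> T q -> T (p * q)%g. Proof. by case: gT => _ + _; exact. Qed.
Let TV p : T p -> T p^-1%g. Proof. by case: gT => _ _; exact. Qed.
Let cT : compact T. Proof. by case: tT. Qed.
Let clT : closed T. Proof. exact: compact_closed (lie_hausdorff (s := K)) cT. Qed.

Lemma cvg_AdM I (F : set_system I) {FF : Filter F} (q : I -> K) z :
  q @ F --> z -> AdM (q p) @[p --> F] --> AdM z.
Proof. by move=> qz; apply: (cvg_comp _ _ qz); exact: AdM_continuous. Qed.

Lemma Ad_continuous w : continuous (fun k : K => Ad c k w).
Proof.
move=> k; have H : w *m AdM l @[l --> k] --> w *m AdM k.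
  by apply: cvg_mulmx; [exact: cvg_cst|exact: (cvg_AdM (@cvg_id _ (nbhs k)))].
rewrite (mulAdM hc) in H; apply: cvg_trans; last exact: H.
by apply: near_eq_cvg; apply: nearW => l; rewrite (mulAdM hc).
Qed.

Section Stabiliser.
Variable w : 'rV[R]_n.
Hypothesis hw : forall H, lie_subalgebra c T H -> bracket c H w = 0.

Let A := [set p | T p /\ Ad c p w = w].

Let A1 : A 1%g. Proof. by split => //; exact: Ad_1. Qed.
Let AMl p q : A p -> A q -> A (p * q)%g.
Proof. by move=> [Tp pw] [Tq qw]; split; [exact: TM|rewrite (Ad_mul hc) qw]. Qed.
Let AVl p : A p -> A p^-1%g.
Proof.
by move=> [Tp pw]; split; [exact: TV|rewrite -{1}pw -(Ad_mul hc) mulVg (Ad_1 hc)].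
Qed.

Let clA : closed A.
Proof.
have -> : A = T `&` (fun k : K => Ad c k w) @^-1` [set w] by [].
apply: closedI; first exact: clT.
apply: preimage_closed.
  by move=> x _; exact: Ad_continuous.
exact/accessible_closed_set1/hausdorff_accessible/norm_hausdorff.
Qed.

Let cA : compact A.
Proof. by apply: subclosed_compact clA cT _ => p []. Qed.

Let len (k : K) : R := `|AdM k - 1%:M|.

Let len_continuous (k : K) : continuous (fun a : K => len (k * a)%g).
Proof.
move=> a; apply: cvg_norm; apply: cvgB; last exact: cvg_cst.
have ka : (k * b)%g @[b --> a] --> (k * a)%g by apply: cvg_mulg => //; exact: cvg_cst.
exact: cvg_AdM.
Qed.

Let ex_repr k : exists a, A a /\ forall b, A b -> len (k * a)%g <= len (k * b)%g.
Proof.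
have cf : {within A, continuous (fun a => len (k * a)%g)}.
  exact/continuous_subspaceT/len_continuous.
have [a aA Ha] := compact_EVT_min (ex_intro _ 1%g A1) cA cf.
by exists a; split; [exact: set_mem|move=> b bA; apply: Ha; exact: mem_set].
Qed.

(* Otherwise there are elements of [T] outside the stabiliser [A] tending to 1,
   and they may be chosen closest to 1 in their cosets of [A], as measured by
   [len].  A limiting direction [u] of them belongs to the Lie algebra of [T],
   so its one-parameter subgroup lies in [A]; multiplying by the inverse of its
   element brings them strictly closer to 1. *)
Lemma stabiliser_near1 : \forall p \near (1%g : K), T p -> Ad c p w = w.
Proof.
apply: contrapT => notA.
pose F0 := within [set p | T p /\ ~ A p] (nbhs (1%g : K)).
have F0P : ProperFilter F0.
  apply: Build_ProperFilter_ex => B B1.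
  have {}B1 : \forall p \near (1%g : K), T p /\ ~ A p -> B p := B1.
  apply: contrapT => nB; apply: notA; apply: filterS B1 => p Bp Tp.
  by apply: contrapT => pw; apply: nB; exists p; apply: Bp; split => // -[].
have [F [FU sF]] := ultraFilterLemma F0P.
have F_T : \forall p \near F, T p /\ ~ A p by apply: sF; exact: withinT.
have F_1 : id @ F --> (1%g : K).
  by move=> U U1; apply: sF; exact: cvg_within U1.
have [r Hr] := choice ex_repr.
(* The default 1 keeps [f] in [T] everywhere, as [lie_subalgebra_limit] demands of [q] below. *)
pose f p := if `[< T p >] then (p * r p)%g else 1%g.
have Tf p : T (f p) by rewrite /f; case: asboolP => // Tp; apply: TM => //; have [[]] := Hr p.
have fE p : T p -> f p = (p * r p)%g by move=> Tp; rewrite /f asboolT.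
have nAf p : T p /\ ~ A p -> ~ A (f p).
  move=> [Tp nAp]; rewrite fE // => Afp; apply: nAp.
  by rewrite -(mulgK (r p) p); apply: AMl => //; apply: AVl; exact: (Hr p).1.
have len_min p b : T p -> A b -> len (f p) <= len (f p * b)%g.
  by move=> Tp Ab; rewrite fE // -mulgA; apply: (Hr p).2; apply: AMl => //; exact: (Hr p).1.
have [z [Tz fz]] : exists z, T z /\ f @ F --> z.
  move: cT; rewrite compact_ultra => /(_ _ (ultra_fmap f FU)) [].
    by apply: nearW.
  by move=> z [Tz fz]; exists z.
have len_cvg (s : K -> K) (y : K) : s @ F --> y -> len (s p) @[p --> F] --> len y.
  move=> sy; apply: cvg_norm; apply: cvgB; last exact: cvg_cst.
  exact: cvg_AdM.
(* [len] does not separate points of [K], so the limit [z] of the chosen representatives need not be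
   1. It acts trivially, hence lies in [A], and dividing by it changes neither [len] nor the
   coset. *)
have Az1 : AdM z = 1%:M.
  have lz : len z <= len 1%g.
    apply: (@ler_cvg_filter _ _ F _ _ _ _ _ (len_cvg _ _ fz) (len_cvg _ _ F_1)).
    apply: filterS F_T => p [Tp _]; rewrite fE //.
    by rewrite -[X in _ <= len X]mulg1; apply: (Hr p).2.
  apply/eqP; rewrite -subr_eq0 -normr_eq0 eq_le normr_ge0 andbT.
  by apply: le_trans lz _; rewrite /len (AdM1 hc) subrr normr0.
have Az : A z by split => //; rewrite -(mulAdM hc) Az1 mulmx1.
pose q p := (f p * z^-1)%g.
have Tq p : T (q p) by apply: TM => //; exact: TV.
have qfz p : f p = (q p * z)%g by rewrite /q mulgVK.
have q1 : q @ F --> (1%g : K).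
  have H := cvg_mulg fz (@cvg_cst _ (z^-1)%g _ F _).
  by rewrite mulgV in H; exact: H.
have nAq p : T p /\ ~ A p -> ~ A (q p).
  by move=> /nAf nA Aq; apply: nA; rewrite qfz; exact: AMl.
pose x p := coord c (q p) - e.
(* The default 1 makes [eps] positive everywhere; along [F] the rescaled coordinates have norm 1, so
   that [u] is nonzero. *)
pose eps p : R := if x p == 0 then 1 else `|x p|.
have eps_gt0 p : 0 < eps p by rewrite /eps; case: ifPn => //; rewrite normr_gt0.
have x0 : x @ F --> (0 : 'rV[R]_n).
  rewrite -(subrr e); apply: cvgB; last exact: cvg_cst; exact: coord_cvg1.
have xn0 : \forall p \near F, x p != 0.
  have N0 : \forall p \near F, param c (coord c (q p)) = q p by exact: near_param_coord.
  apply: filterS2 F_T N0 => p /nAq nA pq; apply/eqP => /subr0_eq xe.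
  by apply: nA; rewrite -pq xe (param_coord1 hc).
have eps0 : eps @ F --> (0 : R).
  have H : `|x p| @[p --> F] --> (0 : R) by apply/norm_cvg0P.
  apply: cvg_trans; last exact: H.
  by apply: near_eq_cvg; apply: filterS xn0 => p xp; rewrite /eps (negPf xp).
have xu : \forall p \near F, `|(eps p)^-1 *: x p| = 1.
  apply: filterS xn0 => p xp; rewrite normrZ normfV /eps (negPf xp) normr_id.
  by rewrite mulVf // normr_eq0.
have [u Hu] : exists u : 'rV[R]_n, (eps p)^-1 *: x p @[p --> F] --> u.
  by apply: (@ultra_bounded_cvg _ _ _ _ _ _ _ 1); apply: filterS xu => p ->.
have u0 : u != 0.
  rewrite -normr_eq0; have : `|u| = 1.
    have H1 : `|(eps p)^-1 *: x p| @[p --> F] --> (`|u| : R) by exact: cvg_norm.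
    have H2 : `|(eps p)^-1 *: x p| @[p --> F] --> (1 : R) by exact: cvg_near_cst.
    exact: (cvg_unique (@Rhausdorff R) H1 H2).
  by move=> ->; exact: oner_neq0.
have [g [gP gT' gu]] := lie_subalgebra_limit hc hK hss FU cT gT Tq eps_gt0 eps0 q1 Hu.
have gA t : A (g t).
  split; first exact: gT'.
  by apply: (Ad_fix_of_bracket0 hc gP gu); apply: hw; exists g; split.
have ge1 : g (eps p) @[p --> F] --> (1%g : K).
  by rewrite -(one_param1 gP); exact: (cvg_comp _ _ eps0 (gP.1 0)).
have quot_q : (eps p)^-1 *: (AdM (q p) - 1%:M) @[p --> F] --> adM u by exact: cvg_AdM_quot.
have quot_g : (eps p)^-1 *: (AdM (g (eps p)) - 1%:M) @[p --> F] --> adM u.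
  have eps_dnbhs : eps @ F --> (0 : R)^'.
    move=> U U0; have H : \forall p \near F, eps p != 0 -> U (eps p) by exact: eps0 _ U0.
    by apply: filterS H => p; apply; rewrite gt_eqF.
  exact: (cvg_comp _ _ eps_dnbhs (one_param_AdM hc gP gu)).
have lim_l : (eps p)^-1 * len (f p) @[p --> F] --> `|adM u|.
  have H : `|(eps p)^-1 *: (AdM (q p) - 1%:M)| @[p --> F] --> `|adM u| by exact: cvg_norm.
  apply: cvg_trans; last exact: H.
  apply: near_eq_cvg; apply: nearW => p.
  rewrite normrZ normfV (gtr0_norm (eps_gt0 p)) /len qfz (AdM_mul hc).
  by rewrite Az1 mul1mx.
have lim_r : (eps p)^-1 * len (f p * g (- eps p))%g @[p --> F] --> (0 : R).
  have H : `|AdM (g (eps p))^-1%g *m ((eps p)^-1 *: (AdM (q p) - 1%:M) -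
     (eps p)^-1 *: (AdM (g (eps p)) - 1%:M))| @[p --> F] --> `|1%:M *m (adM u - adM u)|.
    apply: cvg_norm; apply: cvg_mulmx; last exact: cvgB.
    by apply: AdM_cvg1 => //; rewrite -invg1; exact: cvg_invg.
  rewrite subrr mulmx0 normr0 in H; apply: cvg_trans; last exact: H.
  apply: near_eq_cvg; apply: nearW => p.
  rewrite -scalerBr -scalemxAr normrZ normfV (gtr0_norm (eps_gt0 p)); congr (_ * `|_|).
  rewrite opprB addrA subrK mulmxBr (AdVM hc) (one_paramN _ gP) qfz !(AdM_mul hc).
  by rewrite Az1 mul1mx.
(* Minimality of [len (f p)] in its coset compares the two limits; injectivity of [adM] then
   contradicts [u != 0]. *)
have : `|adM u| <= 0.
  apply: (ler_cvg_filter lim_l lim_r); apply: filterS F_T => p [Tp _].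
  by rewrite ler_wpM2l ?invr_ge0 ?(ltW (eps_gt0 p)) //; exact: len_min.
rewrite normr_le0 => /eqP /(adM_inj hc hss) u00.
by rewrite u00 eqxx in u0.
Qed.

End Stabiliser.
End MaximalTorus.

Lemma closure2 (X Y : topologicalType) (m : X * X -> Y) (S : set X) (C : set Y) :
  continuous m -> closed C -> (forall x y, S x -> S y -> C (m (x, y))) ->
  forall x y, closure S x -> closure S y -> C (m (x, y)).
Proof.
move=> cm cC SC x y Sx Sy; apply: contrapT => nC.
have nbC : nbhs (m (x, y)) (~` C).
  by apply: open_nbhs_nbhs; split => //; exact: closed_openC.
have [[A B] /= [Ax By] AB] := cm (x, y) _ nbC.
have [x' [Sx' Ax']] := Sx _ Ax; have [y' [Sy' By']] := Sy _ By.
by apply: (AB (x', y')) => //; exact: SC.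
Qed.

Section MaximalTorusCentraliser.
Context (R : realType) (n : nat) (K : lieGroupType R n) (c : chart R n K).
Hypotheses (hc : chart_at_1 c) (hK : compact [set: K]) (hss : semisimple c).

(** The stabiliser of [w] in [T] is closed, and it is open in [T] because it is so near 1;
    connectedness of [T] concludes. *)
Lemma torus_fix (T : set K) w : torus T ->
  (forall H, lie_subalgebra c T H -> bracket c H w = 0) ->
  forall p, T p -> Ad c p w = w.
Proof.
move=> tT hw.
have [[T1 TM TV] cT conT _] := tT.
pose A := [set p | T p /\ Ad c p w = w].
suff AT : A = T by move=> p; rewrite -AT => -[].
apply: conT; first by exists 1%g; split => //; exact: Ad_1.
  exists (interior [set p | T p -> Ad c p w = w]); first exact: open_interior.
  apply/seteqP; split => p; last by move=> [Tp /interior_subset]; split => //; auto.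
  move=> [Tp pw]; split => //.
  have pp : (p^-1 * p')%g @[p' --> p] --> (1%g : K).
    have H := cvg_mulg (@cvg_cst _ (p^-1)%g _ (nbhs p) _) (@cvg_id _ (nbhs p)).
    by rewrite mulVg in H; exact: H.
  have H : \forall p' \near p, T (p^-1 * p')%g -> Ad c (p^-1 * p')%g w = w.
    exact: pp _ (stabiliser_near1 hc hK hss tT hw).
  apply: filterS H => p' H Tp'.
  have {}H : Ad c (p^-1 * p')%g w = w by apply: H; apply: TM => //; exact: TV.
  by rewrite -[p'](mulVKg p) (Ad_mul hc) H.
exists ((fun k : K => Ad c k w) @^-1` [set w]) => //.
apply: preimage_closed; first by move=> x _; exact: Ad_continuous.
exact/accessible_closed_set1/hausdorff_accessible/norm_hausdorff.
Qed.

(** The one-parameter subgroup of [w] commutes with [T], so the closure of their product is a torus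
    containing [T], hence equal to [T]. *)
Lemma maximal_torus_centraliser (T : set K) w : maximal_torus T ->
  (forall H, lie_subalgebra c T H -> bracket c H w = 0) -> lie_subalgebra c T w.
Proof.
move=> [tT Tmax] hw.
have [[T1 TM TV] cT conT Tab] := tT.
have [g [gP gw]] := one_param_exists hc hK hss w.
have gT p t : T p -> (p * g t)%g = (g t * p)%g.
  by move=> Tp; apply: (one_param_commute hc hss gP gw); exact: (torus_fix tT hw).
pose S := [set k | exists p t, T p /\ k = (p * g t)%g].
have SM k l : S k -> S l -> S (k * l)%g.
  move=> [p [t [Tp ->]]] [q [s [Tq ->]]]; exists (p * q)%g, (t + s); split; first exact: TM.
  by rewrite gP.2 !mulgA -(mulgA p (g t)) -(gT _ _ Tq) !mulgA.
have SV k : S k -> S (k^-1)%g.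
  move=> [p [t [Tp ->]]]; exists (p^-1)%g, (- t); split; first exact: TV.
  by rewrite (gT _ _ Tp) invgM (one_paramN _ gP).
have Sab k l : S k -> S l -> (k * l)%g = (l * k)%g.
  move=> [p [t [Tp ->]]] [q [s [Tq ->]]].
  rewrite !mulgA -(mulgA p (g t)) -(gT _ _ Tq) -(mulgA q (g s)) -(gT _ _ Tp) !mulgA.
  by rewrite (Tab _ _ Tp Tq) -!mulgA -!gP.2 addrC.
have TS : T `<=` S.
  by move=> p Tp; exists p, 0; rewrite (one_param1 gP) mulg1.
have S_con : connected S.
  (* Each piece joins [T] to a connected translate of [g] through [p], and all pieces contain 1. *)
  have -> : S = \bigcup_(p in T) (T `|` [set (p * g t)%g | t in [set: R]]).
    apply/seteqP; split => k.
      by move=> [p [t [Tp ->]]]; exists p => //; right; exists t.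
    by move=> [p Tp [Tk|[t _ <-]]]; [exact: TS|exists p, t].
  apply: bigcup_connected; first by exists 1%g => p Tp; left.
  move=> p Tp; apply: connectedU => //.
    exists p; split => //; exists 0 => //.
    by rewrite (one_param1 gP) mulg1.
  apply: connected_continuous_connected; first by apply/connected_intervalP => ? ? ? ?.
  apply: continuous_subspaceT => t.
  exact: cvg_mulg (@cvg_cst _ p _ (nbhs t) _) (gP.1 t).
have haus := lie_hausdorff (s := K).
have tS : torus (closure S).
  split.
  - split; first by apply: subset_closure; exact: TS.
      exact: (closure2 (@lie_mul_continuous R n K) (@closed_closure _ S)
        (fun x y Sx Sy => subset_closure (SM _ _ Sx Sy))).
    move=> p Sp; pose m (z : K * K) := (z.1^-1)%g.
    apply: (closure2 (m := m) _ _ _ Sp Sp) => [z| |x y Sx _]; last exact/subset_closure/SV.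
      by apply: (cvg_invg (f := fst)); exact: cvg_fst.
    exact: closed_closure.
  - apply: subclosed_compact hK _ => //; exact: closed_closure.
  - exact: connected_closure.
  (* Commutation is written as membership of one continuous expression in a closed set, so that it
     extends to the closure. *)
  - move=> p q Sp Sq; pose m (z : K * K) := (z.1 * z.2 * (z.2 * z.1)^-1)%g.
    suff : m (p, q) = 1%g by exact: divg1_eq.
    apply: (closure2 (m := m) (C := [set 1%g]) _ _ _ Sp Sq) => [z| |x y Sx Sy /=].
    + have c1 : (fst : K * K -> K) @ z --> z.1 by exact: cvg_fst.
      have c2 : (snd : K * K -> K) @ z --> z.2 by exact: cvg_snd.
      by apply: cvg_mulg; [exact: cvg_mulg|apply: cvg_invg; exact: cvg_mulg].
    + exact/accessible_closed_set1/hausdorff_accessible.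
    + by rewrite /m /= (Sab _ _ Sx Sy) mulgV.
have ST : closure S = T.
  by apply: Tmax => // p /TS; exact: subset_closure.
exists g; split => // t; rewrite -ST; apply: subset_closure.
by exists 1%g, t; rewrite mul1g.
Qed.

End MaximalTorusCentraliser.

(** * Orbits meet the Weyl chamber *)

Section WeylChamber.
Context (R : realType) (n : nat) (K : lieGroupType R n) (c : chart R n K).
Hypotheses (hc : chart_at_1 c) (hK : compact [set: K]) (hss : semisimple c).

Notation e := (coord c 1%g).
Notation AdM := (AdM c).
Notation adM := (adM c).
Notation inner := (inner c).
Notation bracket := (bracket c).
Notation Ad := (Ad c).

Definition gram : 'M[R]_n := \matrix_(i, j) inner (delta_mx 0 i) (delta_mx 0 j).

Lemma inner_form v w : inner v w = form gram v w.
Proof.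
have lad := adM_linear hc.
pose adL := GRing.isLinear.Build _ _ _ _ _ lad.
pose ad : {linear 'rV[R]_n -> 'M[R]_n} := HB.pack adM adL.
have E x : adM x = \sum_i x 0 i *: adM (delta_mx 0 i).
  rewrite {1}(row_sum_delta x) -[adM]/(ad : _ -> _) linear_sum.
  by apply: eq_bigr => i _; rewrite linearZ.
have E1 : \tr (adM w *m adM v) = \sum_j \sum_i
    v 0 i * w 0 j * \tr (adM (delta_mx 0 j) *m adM (delta_mx 0 i)).
  rewrite (E w) mulmx_suml raddf_sum; apply: eq_bigr => j _.
  rewrite (E v) mulmx_sumr raddf_sum; apply: eq_bigr => i _.
  by rewrite /= -scalemxAl -scalemxAr !mxtraceZ mulrA [w 0 j * _]mulrC.
rewrite (innerE hc) E1 /form mxE -sumrN; apply: eq_bigr => j _.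
rewrite mxE mulr_suml -sumrN; apply: eq_bigr => i _.
by rewrite !mxE (innerE hc) mulrN mulNr mulrAC.
Qed.

Lemma inner_sym v w : inner v w = inner w v.
Proof. by rewrite !(innerE hc) mxtrace_mulC. Qed.

Lemma gram_posdef : posdef gram.
Proof.
split; first by apply/matrixP => i j; rewrite !mxE inner_sym.
by move=> x x0; rewrite -/(form gram x x) -inner_form; exact: inner_gt0.
Qed.

Lemma AdKV k v : Ad k (Ad k^-1%g v) = v.
Proof. by rewrite -!(mulAdM hc) -mulmxA (AdVM hc) mulmx1. Qed.

Lemma inner_Ad k v w : inner (Ad k v) (Ad k w) = inner v w.
Proof.
rewrite !(innerE hc) !(adM_Ad hc) -!mulmxA (mulmxA (AdM k)) (AdMV hc) mul1mx.
by rewrite mulmxA mxtrace_mulC !mulmxA -(mulmxA _ (AdM k)) (AdMV hc) mulmx1 mxtrace_mulC.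
Qed.

Lemma adM0 : adM 0 = 0.
Proof.
have H : adM (0 *: (0 : 'rV[R]_n)) = 0 *: adM 0.
  exact: (GRing.scalable_linear (adM_linear hc) 0 (0 : 'rV[R]_n)).
by rewrite !scale0r in H.
Qed.

(** Invariance of the Killing form: the Jacobi identity and cyclicity of the trace. One form thus
    makes all [adM u] skew simultaneously. *)
Lemma inner_adM u v w : inner (v *m adM u) w = - inner v (w *m adM u).
Proof.
have E x : adM (x *m adM u) = adM x *m adM u - adM u *m adM x.
  by rewrite (muladM hc) (adM_bracket hc).
rewrite !(innerE hc) !E; move: (adM u) (adM v) (adM w) => U V W.
have tB (A B : 'M[R]_n) : \tr (A - B) = \tr A - \tr B by rewrite raddfB.
rewrite opprK mulmxBr mulmxBl !tB opprB !mulmxA; congr (_ - _).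
by rewrite mxtrace_mulC !mulmxA.
Qed.

Lemma gram_skew u : adM u *m gram + gram *m (adM u)^T = 0.
Proof.
apply/eqP; rewrite addr_eq0; apply/eqP/matrixP => i j.
have E (A : 'M[R]_n) : A i j =
    ((delta_mx 0 i : 'rV[R]_n) *m A *m (delta_mx 0 j : 'rV[R]_n)^T : 'M[R]_1) 0 0.
  by rewrite -rowE trmx_delta -colE !mxE.
transitivity (form gram (delta_mx 0 i *m adM u) (delta_mx 0 j)).
  by rewrite E /form mulmxA.
rewrite -inner_form inner_adM inner_form.
by rewrite [RHS]E /form trmx_mul mulmxN mulNmx [RHS]mxE !mulmxA.
Qed.

Section Regular.
Variables (T : set K) (tT : torus T) (xi : 'rV[R]_n).
Let h := lie_subalgebra c T.
Hypotheses (hxi : h xi) (xi_reg : forall alpha, real_root c h alpha -> alpha xi != 0).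

Lemma torus_bracket0 H H' : h H -> h H' -> bracket H H' = 0.
Proof.
move=> [g [gP gT gH]] [g' [gP' gT' gH']].
apply: (bracket0_of_Ad_fix hc gP gH) => t.
apply: (Ad_commuting hc gP' gH') => s.
by case: tT => _ _ _; apply.
Qed.

(** Otherwise the image under [ad H0] of the kernel of [ad xi] is a nonzero subspace stable under
    [h]. A common rotation plane in it carries a root nonzero at [H0], yet [xi] kills the subspace,
    so this root vanishes at [xi]. *)
Lemma regular_centraliser w : bracket xi w = 0 -> forall H, h H -> bracket H w = 0.
Proof.
move=> xiw H0 hH0; apply: contrapT => /eqP H0w.
pose Ms := [set adM H | H in h].
have comm M M' : Ms M -> Ms M' -> M *m M' = M' *m M.
  move=> [H hH <-] [H' hH' <-]; apply/eqP; rewrite -subr_eq0 -(adM_bracket hc).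
  by rewrite (torus_bracket0 hH' hH) adM0.
have skew M : Ms M -> M *m gram + gram *m M^T = 0.
  by move=> [H _ <-]; exact: gram_skew.
have Mxi : Ms (adM xi) by exists xi.
have MH0 : Ms (adM H0) by exists H0.
pose V1 := kermx (adM xi) *m adM H0.
have kerV (M : 'M[R]_n) : Ms M -> kermx (adM xi) *m M *m adM xi = 0.
  by move=> MM; rewrite -mulmxA (comm _ _ MM Mxi) mulmxA mulmx_ker mul0mx.
have V1xi (x : 'rV[R]_n) : (x <= V1)%MS -> x *m adM xi = 0.
  by move=> /submxP[y ->]; rewrite -mulmxA kerV // mulmx0.
have V1i : invariant Ms V1.
  split.
    apply/rowV0Pn; exists (w *m adM H0); last by rewrite (muladM hc).
    by apply: submxMr; apply/sub_kermxP; rewrite (muladM hc).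
  move=> M MM; rewrite -mulmxA (comm _ _ MH0 MM) mulmxA; apply: submxMr.
  by apply/sub_kermxP; exact: kerV.
(* Kernel and image of a skew operator are orthogonal. *)
have inj0 (x : 'rV[R]_n) : (x <= V1)%MS -> x *m adM H0 = 0 -> x = 0.
  move=> /submxP[y xE] x0; apply: (form_eq0 gram_posdef).
  by rewrite {1}xE mulmxA (form_skew skew) // x0 (form_sym gram_posdef) form0l oppr0.
have [X [Y [X0 XV YV [b bH0 Hb]]]] := common_rotation gram_posdef skew comm V1i MH0 inj0.
(* Pairing with [X] extends the coefficient [b], known only on the matrices of [h], to a linear
   functional on the whole Lie algebra, as [real_root] asks. *)
pose al v := inner (Y *m adM v) X / inner X X.
have XX : inner X X != 0 by rewrite gt_eqF // inner_gt0.
have alE H : h H -> al H = b (adM H).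
  move=> hH; have [|_ YM] := Hb (adM H); first by exists H.
  by rewrite /al YM !inner_form formZl -inner_form mulfK.
have al_lin : scalar al.
  move=> a u v; rewrite /al (adM_linear hc a u v) mulmxDr -scalemxAr !inner_form formDl formZl.
  by rewrite mulrDl mulrA.
pose alM := GRing.isLinear.Build _ _ _ _ al al_lin.
pose alpha : {scalar 'rV[R]_n} := HB.pack al alM.
have root : real_root c h alpha.
  split; first by exists H0 => //; rewrite [alpha H0](alE _ hH0).
  exists X, Y; split; first by apply: contra_neq X0 => -[].
  move=> H hH; rewrite -!(muladM hc) [alpha H](alE _ hH).
  by apply: Hb; exists H.
have := xi_reg root; rewrite [alpha xi](alE _ hxi).
have [_ ] := Hb _ Mxi; rewrite (V1xi _ YV) => /esym/eqP.
by rewrite scaler_eq0 (negPf X0) orbF => ->.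
Qed.

End Regular.

Lemma innerBl x y z : inner (x - y) z = inner x z - inner y z.
Proof. by rewrite !inner_form formDl -scaleN1r formZl mulN1r. Qed.

Lemma inner_moved_ge0 x y x1 y1 x2 :
  inner x1 y1 = inner x y -> inner x y1 = inner x2 y ->
  inner x1 y <= inner x y -> inner x2 y <= inner x y ->
  0 <= inner (x1 - x) (y1 - y).
Proof.
by rewrite !inner_form => E1 E2 E3 E4; exact: (form_moved_ge0 gram_posdef E1 E2 E3 E4).
Qed.

Lemma adMC x y : x *m adM y = - (y *m adM x).
Proof. by rewrite !(muladM hc); exact: bracketC. Qed.

Lemma orbit_meets_chamber (T : set K) P mu : maximal_torus T ->
  positive_roots c (lie_subalgebra c T) P ->
  exists k, weyl_chamber (lie_subalgebra c T) P (Ad k mu).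
Proof.
move=> hT [xi [hxi xi_reg] ->]; have [tT _] := hT.
have cvg_in I (F : set_system I) (FF : Filter F) (f g : I -> 'rV[R]_n) (x y : 'rV[R]_n) :
    f @ F --> x -> g @ F --> y -> inner (f i) (g i) @[i --> F] --> inner x y.
  move=> fx gy; rewrite inner_form; under eq_fun do rewrite inner_form.
  exact: (cvg_form fx gy).
have cf : {within [set: K], continuous (fun k => inner (Ad k mu) xi)}.
  apply: continuous_subspaceT => k; apply: cvg_in; last exact: cvg_cst.
  exact: Ad_continuous.
have [k0 _ Hmax] := compact_EVT_max (ex_intro _ 1%g I) hK cf.
exists k0; set mu' := Ad k0 mu.
have {}Hmax k : inner (Ad k mu') xi <= inner mu' xi.
  by rewrite /mu' -(Ad_mul hc); apply: Hmax; rewrite inE.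
clearbody mu'.
pose eps : nat -> R := harmonic.
have eps_gt0 i : 0 < eps i by rewrite invr_gt0 ltr0n.
pose q v i := param c (e + eps i *: v).
have quot v w : (eps i)^-1 *: (Ad (q v i) w - w) @[i --> \oo] --> w *m adM v.
  have [q1 qv] : q v i @[i --> \oo] --> (1%g : K) /\
     (eps i)^-1 *: (coord c (q v i) - e) @[i --> \oo] --> v.
    apply: (param_line hc); first exact: cvg_harmonic.
    by apply: nearW => i; rewrite gt_eqF.
  have H : w *m ((eps i)^-1 *: (AdM (q v i) - 1%:M)) @[i --> \oo] --> w *m adM v.
    by apply: cvg_mulmx; [exact: cvg_cst|exact: cvg_AdM_quot].
  apply: cvg_trans; last exact: H.
  apply: near_eq_cvg; apply: nearW => i /=.
  by rewrite -scalemxAr mulmxBr mulmx1 (mulAdM hc).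
have le0 v : inner (mu' *m adM v) xi <= 0.
  have H : inner ((eps i)^-1 *: (Ad (q v i) mu' - mu')) xi @[i --> \oo] --> inner (mu' *m adM v) xi.
    by apply: cvg_in; [exact: quot|exact: cvg_cst].
  apply: (cvgr_to_le H); apply: nearW => i; rewrite inner_form formZl -inner_form innerBl.
  by rewrite pmulr_rle0 ?invr_gt0 // subr_le0.
(* Holds for every [k], not just infinitesimally; dividing by [eps i ^+ 2] along [q v] yields the
   second-order condition. *)
have key k : 0 <= inner (Ad k mu' - mu') (Ad k xi - xi).
  have E2 := inner_Ad k (Ad k^-1%g mu') xi; rewrite AdKV in E2.
  exact: (inner_moved_ge0 (inner_Ad k mu' xi) E2 (Hmax k) (Hmax k^-1%g)).
have ge0 v : 0 <= inner (mu' *m adM v) (xi *m adM v).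
  have H : inner ((eps i)^-1 *: (Ad (q v i) mu' - mu')) ((eps i)^-1 *: (Ad (q v i) xi - xi))
      @[i --> \oo] --> inner (mu' *m adM v) (xi *m adM v).
    by apply: cvg_in; exact: quot.
  apply: (cvgr_to_ge H); apply: nearW => i.
  rewrite inner_form (formZr gram_posdef) formZl -inner_form !pmulr_rge0 ?invr_gt0 //; exact: key.
(* The first-order inequality in the direction [- z] reads [<z, z> <= 0]. *)
have ximu : mu' *m adM xi = 0.
  have [z zE] : exists z, z = mu' *m adM xi by exists (mu' *m adM xi).
  have E : inner (mu' *m adM (- z)) xi = inner z z.
    rewrite adMC mulNmx opprK inner_adM (adMC xi) -zE !inner_form.
    by rewrite (formNr gram_posdef) opprK.
  have := le0 (- z); rewrite E inner_form -zE => zz.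
  by apply: (form_eq0 gram_posdef); apply/eqP; rewrite eq_le zz (form_ge0 gram_posdef).
have hmu : lie_subalgebra c T mu'.
  apply: maximal_torus_centraliser => // H hH.
  by apply: (regular_centraliser tT hxi xi_reg) => //; rewrite -(muladM hc).
split => // al [[_ [X [Y [XY0 HXY]]]] al_xi].
have [XH _] := HXY _ hmu; have [Xxi Yxi] := HXY _ hxi.
rewrite -(muladM hc) in XH; rewrite -(muladM hc) in Xxi; rewrite -(muladM hc) in Yxi.
have Y0 : Y != 0.
  apply: contraNneq XY0 => Y0; move: Yxi; rewrite Y0 mul0mx => /esym/eqP.
  by rewrite scaler_eq0 gt_eqF //= => /eqP ->.
(* Both moved vectors are multiples of [Y], so the inequality is [al(mu') al(xi) <Y, Y> >= 0]. *)
have := ge0 X.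
rewrite (adMC mu' X) (adMC xi X) XH Xxi -!scaleNr !opprK.
rewrite inner_form formZl (formZr gram_posdef) mulrA.
by rewrite pmulr_lge0 ?(form_gt0 gram_posdef) // pmulr_lge0.
Qed.

End WeylChamber.

(** * Polar duality *)

Section Polarity.
Context (R : realType) (n : nat) (S : 'M[R]_n).
Hypothesis Sp : posdef S.
Variable N : 'rV[R]_n -> R.
Hypothesis hN : finsler_norm N.

Let N_ge0 v : 0 <= N v. Proof. by case: hN. Qed.
Let ND v w : N (v + w) <= N v + N w. Proof. by case: hN. Qed.
Let NZ (l : R) v : 0 <= l -> N (l *: v) = l * N v. Proof. by case: hN => _ _ _; exact. Qed.

Lemma finsler0 : N 0 = 0.
Proof. by rewrite -(scale0r (0 : 'rV[R]_n)) NZ // mul0r. Qed.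

Lemma finsler_gt0 v : v != 0 -> 0 < N v.
Proof.
move=> v0; rewrite lt_neqAle N_ge0 andbT eq_sym.
by apply: contra_neq v0; case: hN => _ _ + _; exact.
Qed.

Lemma finsler_bounded : exists2 C : R, 0 < C & forall x, N x <= C * `|x|.
Proof.
pose C := \sum_(i < n) (N (delta_mx 0 i) + N (- delta_mx 0 i)).
exists (C + 1); first by rewrite ltr_wpDl // sumr_ge0 // => i _; rewrite addr_ge0.
move=> x.
have Nsum (I : Type) (r : seq I) (f : I -> 'rV[R]_n) : N (\sum_(i <- r) f i) <= \sum_(i <- r) N (f i).
  elim: r => [|i r IH]; first by rewrite !big_nil finsler0.
  by rewrite !big_cons; apply: le_trans (ND _ _) _; rewrite lerD2l.
rewrite {1}(row_sum_delta x); apply: le_trans (Nsum _ _ _) _.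
apply: (@le_trans _ _ (C * `|x|)); last by rewrite ler_wpM2r // lerDl.
rewrite mulr_suml; apply: ler_sum => i _.
have xi := mx_norm_entry x 0 i.
have [x0|x0] := lerP 0 (x 0 i).
  rewrite NZ // mulrC; rewrite ger0_norm // in xi.
  by apply: ler_pM => //; rewrite lerDl.
rewrite -[_ *: _]opprK -scaleNr -scalerN NZ ?oppr_ge0 ?(ltW x0) // mulrC.
rewrite ltr0_norm // in xi; apply: ler_pM => //; first by rewrite oppr_ge0 ltW.
by rewrite lerDr.
Qed.

Lemma finsler_cvg T (F : set_system T) {FF : Filter F} (f : T -> 'rV[R]_n) (x : 'rV[R]_n) :
  f @ F --> x -> N (f i) @[i --> F] --> N x.
Proof.
move=> fx; have [C C0 HC] := finsler_bounded.
apply/cvgrPdist_le => d d0.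
have d1 : 0 < d / C by rewrite divr_gt0.
move/cvgrPdist_le/(_ _ d1) : fx; apply: filterS => i; rewrite ler_pdivlMr // mulrC => H.
have NB u v : N u - N v <= C * `|u - v|.
  by apply: le_trans (HC _); rewrite lerBlDr -{1}(subrK v u).
rewrite ler_norml; apply/andP; split; last exact: le_trans (NB _ _) H.
by rewrite lerNl opprB; apply: le_trans (NB _ _) _; rewrite distrC.
Qed.

Lemma finsler_continuous : continuous N.
Proof. by move=> x; exact: (finsler_cvg (@cvg_id _ (nbhs x))). Qed.

Definition form_polar := [set mu | forall x, N x <= 1 -> form S x mu <= 1].

Lemma form_polar_le mu x : form_polar mu -> form S x mu <= N x.
Proof.
move=> Hmu; have [->|x0] := eqVneq x 0; first by rewrite form0l finsler0.
have Nx := finsler_gt0 x0.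
have := Hmu ((N x)^-1 *: x); rewrite NZ ?invr_ge0 // mulVf ?gt_eqF // => /(_ (lexx _)).
by rewrite formZl ler_pdivrMl // mulr1.
Qed.

(** Testing [mu] against itself gives [a |mu|^2 <= <mu, mu> <= N mu <= C |mu|], hence the radius
    [C / a]. *)
Lemma form_polar_compact : compact form_polar.
Proof.
have [C C0 HC] := finsler_bounded.
have [a a0 Ha] := form_lower Sp.
apply: bounded_closed_compact.
  exists (C / a); split; first exact: num_real.
  move=> M CM mu Hmu; apply: le_trans (ltW CM).
  have H1 := le_trans (Ha mu) (le_trans (form_polar_le mu Hmu) (HC mu)).
  have [->|mu0] := eqVneq mu 0; first by rewrite normr0 divr_ge0 ?ltW.
  rewrite ler_pdivlMr // -(@ler_pM2r _ `|mu|) ?normr_gt0 //.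
  by rewrite [`|mu| * a]mulrC -mulrA -expr2.
have -> : form_polar = \bigcap_(x in [set x | N x <= 1]) ((form S x) @^-1` [set r | r <= 1]) by [].
apply: closed_bigI => x _; apply: preimage_closed; last exact: closed_le.
move=> mu _; exact: (cvg_form (@cvg_cst _ x _ (nbhs mu) _) (@cvg_id _ (nbhs mu))).
Qed.

(* The difference between [z] and its nearest point in the unit ball separates
   [z] from the ball. *)
Lemma form_separation z : 1 < N z -> exists2 mu, form_polar mu & 1 < form S z mu.
Proof.
move=> Nz.
pose q b := form S (z - b) (z - b).
(* Points farther from [z] than 0 are discarded: [D] is then bounded by the form alone, and a
   nearest point of [D] is nearest in the whole ball. *)
pose D := [set b | N b <= 1 /\ q b <= form S z z].
have cq : continuous q.
  move=> b; have cb : z - y @[y --> b] --> z - b.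
    exact: (cvgB (@cvg_cst _ z _ (nbhs b) _) (@cvg_id _ (nbhs b))).
  exact: (cvg_form cb cb).
have D0 : D !=set0 by exists 0; split; rewrite ?finsler0 // /q subr0.
have cD : compact D.
  have [a a0 Ha] := form_lower Sp.
  apply: bounded_closed_compact.
    pose r := form S z z / a + 1.
    have ra : a * r = form S z z + a by rewrite /r mulrDr mulr1 mulrCA divff ?gt_eqF // mulr1.
    have zz := form_ge0 Sp z.
    have r1 : 1 <= r by rewrite lerDr divr_ge0 // ltW.
    exists (`|z| + r); split; first exact: num_real.
    move=> M rM b [_ qb]; apply: le_trans (ltW rM).
    have zb : `|z - b| <= r.
      rewrite leNgt; apply/negP => rzb.
      have := le_trans (Ha (z - b)) qb; apply/negP; rewrite -ltNge.
      apply: (@lt_le_trans _ _ (a * r)); first by rewrite ra ltrDl.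
      by rewrite ler_pM2l // expr2 -[r]mulr1; apply: ler_pM => //; lra.
    by rewrite -[b](subKr z); apply: le_trans (ler_normB _ _) _; rewrite lerD2l.
  have -> : D = N @^-1` [set r | r <= 1] `&` q @^-1` [set r | r <= form S z z] by [].
  apply: closedI; apply: preimage_closed; try exact: closed_le.
    by move=> b _; exact: finsler_continuous.
  by move=> b _; exact: cq.
have [b /set_mem[Nb qb] bmin] := compact_EVT_min D0 cD (continuous_subspaceT cq).
have {}bmin y : N y <= 1 -> q b <= q y.
  move=> Ny; have [le|le] := lerP (q y) (form S z z); last by apply: ltW; apply: le_lt_trans le.
  by apply: bmin; apply/mem_set; split.
have [m mE] : exists m, m = z - b by exists (z - b).
have m0 : m != 0 by rewrite mE subr_eq0; apply: contraTneq Nz => ->; rewrite -leNgt.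
have mm : 0 < form S m m by exact: form_gt0.
have var y : N y <= 1 -> form S y m <= form S b m.
  move=> Ny; rewrite -subr_le0 -formBl leNgt; apply/negP.
  have [w wE] : exists w, w = y - b by exists (y - b).
  rewrite -wE.
  set k := form S w m => k0.
  have ww := form_ge0 Sp w.
  have w1 : 0 < form S w w + 1 by rewrite ltr_wpDl.
  (* [t <= 1] keeps [b + t w] in the ball by convexity, and [t (<w,w> + 1) <= k] makes the squared
     distance to [z] drop strictly. *)
  pose t := Num.min 1 (k / (form S w w + 1)).
  have t0 : 0 < t by rewrite lt_min ltr01 divr_gt0.
  have t1 : t <= 1 by rewrite ge_min lexx.
  have tk : t * (form S w w + 1) <= k by rewrite -ler_pdivlMr // ge_min lexx orbT.
  have Nt : N (b + t *: w) <= 1.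
    have -> : b + t *: w = (1 - t) *: b + t *: y.
      by rewrite wE scalerBr scalerBl scale1r addrCA addrC.
    apply: le_trans (ND _ _) _; rewrite !NZ ?subr_ge0 // ?(ltW t0) //.
    have h1 : (1 - t) * N b <= 1 - t by rewrite -[leRHS]mulr1 ler_wpM2l // subr_ge0.
    have h2 : t * N y <= t by rewrite -[leRHS]mulr1 ler_wpM2l // ltW.
    by move: h1 h2; lra.
  have := bmin _ Nt; rewrite /q opprD addrA -mE.
  have -> : form S (m - t *: w) (m - t *: w) = form S m m - 2 * t * k + t ^+ 2 * form S w w.
    rewrite formBl !(form_sym Sp _ (m - _)) !formBl !formZl !(formZr Sp) (form_sym Sp m w).
    by rewrite -/k; ring.
  have := mulr_gt0 t0 k0; move: tk => /(ler_wpM2l (ltW t0)).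
  by rewrite expr2; move: t0; nra.
have s0 : 0 < form S b m.
  have Nm := finsler_gt0 m0.
  apply: lt_le_trans (var ((N m)^-1 *: m) _); last by rewrite NZ ?invr_ge0 // mulVf // gt_eqF.
  by rewrite formZl mulr_gt0 // invr_gt0.
exists ((form S b m)^-1 *: m).
  by move=> y Ny; rewrite formZr // ler_pdivrMl // mulr1; exact: var.
rewrite formZr // ltr_pdivlMl // mulr1.
by rewrite -[z in X in _ < X](subrK b) -mE formDl ltrDr.
Qed.

Lemma form_polar_attained x : x != 0 -> exists2 mu, form_polar mu & form S x mu = N x.
Proof.
move=> x0; have Nx := finsler_gt0 x0.
have P0 : form_polar 0 by move=> y _; rewrite form_sym // form0l.
have cf : {within form_polar, continuous (form S x)}.
  apply: continuous_subspaceT => mu.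
  exact: (cvg_form (@cvg_cst _ x _ (nbhs mu) _) (@cvg_id _ (nbhs mu))).
have [mu /set_mem Hmu mumax] := compact_EVT_max (ex_intro _ 0 P0) form_polar_compact cf.
exists mu => //; apply/eqP; rewrite eq_le form_polar_le //= leNgt; apply/negP => lt.
(* If the maximum were below [N x], scaling [x] by this intermediate value would put it outside the
   ball, and a separating [nu] in the polar would exceed the maximum. *)
pose t := (form S x mu + N x) / 2.
have mu_ge0 : 0 <= form S x mu.
  by have := mumax 0 (mem_set P0); rewrite form_sym // form0l.
have t0 : 0 < t by rewrite /t; lra.
have [nu Hnu] : exists2 nu, form_polar nu & 1 < form S (t^-1 *: x) nu.
  apply: form_separation; rewrite NZ ?invr_ge0 ?ltW // ltr_pdivlMl // mulr1.
  by rewrite /t; lra.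
rewrite formZl ltr_pdivlMl // mulr1.
by have := mumax _ (mem_set Hnu); rewrite /t; lra.
Qed.
End Polarity.

(** * Boundary points of the polar dual and invariance under Ad *)

Section PolarBoundary.
Context (R : realType) (n : nat) (K : lieGroupType R n) (c : chart R n K).
Hypotheses (hc : chart_at_1 c) (hK : compact [set: K]) (hss : semisimple c).
Variable N : 'rV[R]_n -> R.
Hypotheses (hN : finsler_norm N) (hAd : Ad_invariant c N).

Let Sp := gram_posdef hc hK hss.

Lemma polarE : polar c (unit_ball N) = form_polar (gram c) N.
Proof.
by apply/seteqP; split => mu Hmu x Nx; [rewrite -(inner_form hc)|rewrite (inner_form hc)]; exact: Hmu.
Qed.

Lemma inner_Adr k x mu : inner c x (Ad c k mu) = inner c (Ad c k^-1%g x) mu.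
Proof. by have E := inner_Ad hc k (Ad c k^-1%g x) mu; rewrite (AdKV hc) in E. Qed.

Lemma polar_inner_le mu x : form_polar (gram c) N mu -> inner c x mu <= N x.
Proof. by rewrite (inner_form hc); exact: form_polar_le. Qed.

Lemma polar_orbit_le k mu x : form_polar (gram c) N mu -> inner c x (Ad c k mu) <= N x.
Proof.
move=> Hmu; rewrite inner_Adr -[leRHS](hAd k^-1%g); exact: polar_inner_le.
Qed.

Lemma polar_Ad k mu : form_polar (gram c) N mu -> form_polar (gram c) N (Ad c k mu).
Proof.
by move=> Hmu x Nx; rewrite -(inner_form hc); apply: le_trans (polar_orbit_le _ _ Hmu) Nx.
Qed.

(** Stretching [mu] by any factor above 1 raises its pairing with [x] beyond [N x > 0], so it leaves
    the polar; [s] is small enough for the stretched point to stay within [r]. *)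
Lemma polar_boundary mu x : x != 0 -> form_polar (gram c) N mu -> inner c x mu = N x ->
  boundary (form_polar (gram c) N) mu.
Proof.
move=> x0 Hmu xmu; split; first exact: subset_closure.
move=> /near_norm_le[r r0 Hr].
have Nx := finsler_gt0 hN x0.
pose s := r / (`|mu| + 1).
have m1 : 0 < `|mu| + 1 by rewrite ltr_wpDl.
have s0 : 0 < s by rewrite divr_gt0.
have Hs : form_polar (gram c) N (mu + s *: mu).
  apply: Hr; rewrite addrAC subrr add0r normrZ gtr0_norm // /s mulrAC ler_pdivrMr //.
  by rewrite ler_wpM2l ?lerDl // ltW.
have := polar_inner_le x Hs.
rewrite (inner_form hc) (formDr Sp) (formZr Sp) -(inner_form hc) xmu.
by rewrite gerDl leNgt mulr_gt0.
Qed.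

Lemma polar_boundary_sub mu : boundary (form_polar (gram c) N) mu -> form_polar (gram c) N mu.
Proof.
have cl : closed (form_polar (gram c) N).
  exact: compact_closed (@norm_hausdorff _ _) (form_polar_compact Sp hN).
by move=> [+ _]; rewrite -((closure_id _).1 cl).
Qed.

End PolarBoundary.

Theorem theorem5p8 (R : realType) (n : nat) (K : lieGroupType R n)
  (c : chart R n K) (hc : chart_at_1 c) (hn : (0 < n)%N)
  (hK : compact [set: K]) (hss : semisimple c)
  (T : set K) (hT : maximal_torus T)
  (P : set {scalar 'rV[R]_n}) (hP : positive_roots c (lie_subalgebra c T) P)
  (N : 'rV[R]_n -> R) (hN : finsler_norm N) (hAd : Ad_invariant c N)
  (x : 'rV[R]_n) :
  (N x)%:E =
  ereal_sup [set (orbit_norm c mu x)%:E | mu in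
    boundary (polar c (unit_ball N)) `&` weyl_chamber (lie_subalgebra c T) P].
Proof.
have Sp := gram_posdef hc hK hss.
rewrite (polarE hc).
have orbit_ub mu y : form_polar (gram c) N mu ->
    ubound [set inner c y (Ad c k mu) | k in [set: K]] (N y).
  by move=> Hmu _ [k _ <-]; exact: polar_orbit_le.
have ex_mu y : y != 0 -> exists mu, [/\ boundary (form_polar (gram c) N) mu,
    weyl_chamber (lie_subalgebra c T) P mu & exists k, inner c y (Ad c k mu) = N y].
  move=> y0; have [nu nuP ynu] := form_polar_attained Sp hN y0.
  have [k kC] := orbit_meets_chamber hc hK hss nu hT hP.
  exists (Ad c k nu); split => //.
  (* [nu] attains [N y] at [y], so the moved point attains the same value at [Ad c k y]. *)
  - apply: (polar_boundary hc hK hss hN (x := Ad c k y)).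
    + apply/eqP => ky0; have := finsler_gt0 hN y0.
      by rewrite -(hAd k) ky0 (finsler0 hN) ltxx.
    + exact: polar_Ad.
    + by rewrite (inner_Ad hc) (inner_form hc) ynu hAd.
  - exists (k^-1)%g; rewrite -(Ad_mul hc) mulVg (Ad_1 hc) (inner_form hc).
    exact: ynu.
apply/eqP; rewrite eq_le; apply/andP; split; last first.
  apply: ge_ereal_sup => _ [mu [Bmu _] <-]; rewrite lee_fin.
  apply: ge_sup; last exact/orbit_ub/polar_boundary_sub.
  by exists (inner c x (Ad c 1%g mu)), 1%g.
suff [mu [Bmu Cmu [k xk]]] : exists mu, [/\ boundary (form_polar (gram c) N) mu,
    weyl_chamber (lie_subalgebra c T) P mu & exists k, inner c x (Ad c k mu) = N x].
  apply: le_trans (ereal_sup_ubound _); last by exists mu.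
  rewrite lee_fin -xk; apply: ub_le_sup; last by exists k.
  by exists (N x); apply: orbit_ub; exact: polar_boundary_sub.
have [->|x0] := eqVneq x 0; last exact: ex_mu.
(* At [x = 0] every orbit norm is 0, but an empty index set would give the supremum [-oo]. Any
   nonzero vector supplies a member; it exists because [0 < n]. *)
have y0 : const_mx 1 != 0 :> 'rV[R]_n.
  by apply/eqP => /rowP/(_ (Ordinal hn))/eqP; rewrite !mxE oner_eq0.
have [mu [Bmu Cmu _]] := ex_mu _ y0.
by exists mu; split => //; exists 1%g; rewrite (inner_form hc) form0l (finsler0 hN).
Qed.
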